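(* Let $n$ be a positive integer and let $w\in W_{\mathrm{af}}^0$ (type $C_n^{(1)}$) satisfy $\ell(w)\le 2n$. Then $\lambda_w$ is a strict partition and $$\hat P^{(n)}_w(y|a)=\hat P_{\lambda_w}(y|a^{(n)}),$$ where $\hat P^{(n)}_w(y|a)$ is the dual affine Schur $P$-function and the right-hand side is the dual factorial $P$-function $\hat P_{\lambda_w}(y|a_1,a_2,\dots)$ with each $a_i$ ($i\ge1$) replaced by $a_i^{(n)}$.
   Context: Type $C_n$ data. $S=\mathbb{C}[a_1,\dots,a_n]$; $\alpha_i=a_i-a_{i+1}$ ($1\le i\le n-1$), $\alpha_n=2a_n$, $\alpha_0=-2a_1$. $W=\langle s_1,\dots,s_n\rangle$ is the group of signed permutations of $a_1,\dots,a_n$ ($s_i$ swaps $a_i,a_{i+1}$ for $i<n$; $s_n$ negates $a_n$). $W_{\mathrm{af}}=W\ltimes Q^\vee=\langle s_0,\dots,s_n\rangle$ is the affine Weyl group of type $C_n^{(1)}$, $Q^\vee=\bigoplus_i\mathbb{Z}\varepsilon_i$ with $\{\varepsilon_i\}$ dual to $\{a_i\}$, $s_0=t_{\varepsilon_1}s_\theta$ with $\theta=2a_1$; $\ell$ is its length function. $W_{\mathrm{af}}^0$ is the set of minimal length representatives of the cosets $W_{\mathrm{af}}/W$. Dual affine Schur $P$-functions. $\hat\Lambda_S$ is the ring of formal sums $\sum_{k\ge0}f_k$, $f_k\in S\otimes\Lambda_k$, with $\Lambda_k$ the degree $k$ symmetric functions in $y=(y_1,y_2,\dots)$. Put $\Omega(u|y)=\prod_j\frac{1+uy_j}{1-uy_j}$.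 Let $s_i$ ($1\le i\le n$) act on $\hat\Lambda_S$ through the coefficients $S$, and $s_0f=\Omega(a_1|y)\,f|_{a_1\mapsto-a_1}$. Let $A_if=\alpha_i^{-1}(f-s_if)$ for $0\le i\le n$; the $A_i$ satisfy the braid relations, so $A_w$ is defined for $w\in W_{\mathrm{af}}$. For $w\in W_{\mathrm{af}}^0$, $\hat P_w^{(n)}(y|a)=A_w(1)\in\hat\Lambda_S$. The bijection $w\mapsto\lambda_w$. Put $\rho_i=s_{i-1}\cdots s_1s_0$ for $1\le i\le n$ and $\rho_i=s_{2n+1-i}\cdots s_{n-1}s_ns_{n-1}\cdots s_1s_0$ for $n+1\le i\le 2n$. Let $\mathscr{P}_C^n$ be the set of partitions with all parts at most $2n$ having at most one part of each size $k$ for $1\le k\le n$. The known bijection $W_{\mathrm{af}}^0\to\mathscr{P}_C^n$, $w\mapsto\lambda_w$, is inverse to $\lambda=(\lambda_1\ge\dots\ge\lambda_l>0)\mapsto\rho_{\lambda_l}\cdots\rho_{\lambda_2}\rho_{\lambda_1}$ (a length-additive product, so $\ell(w)=|\lambda_w|$). Parameters $a^{(n)}$. $(a^{(n)}_1,\dots,a^{(n)}_{2n})=(a_1,\dots,a_n,-a_n,\dots,-a_1)$ and $a^{(n)}_{i+2nk}=a^{(n)}_i$ for $k\ge1$. Dual factorial $P$-functions. Let $a=(a_1,a_2,\dots)$ be infinitely many parameters and $(\!(x|a)\!)^k=2x(x-a_1)\cdots(x-a_{k-1})$ (so $(\!(x|a)\!)^1=2x$). For a strict partition $\lambda$ with $\ell(\lambda)$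 nonzero parts, the factorial $Q$-function is $$Q_\lambda(x_1,\dots,x_N|a)=\frac{1}{(N-\ell(\lambda))!}\sum_{w\in S_N}w\Big(\prod_{i=1}^{\ell(\lambda)}(\!(x_i|a)\!)^{\lambda_i}\prod_{i=1}^{\ell(\lambda)}\prod_{j=i+1}^N\frac{x_i+x_j}{x_i-x_j}\Big)$$ for $N\ge\ell(\lambda)$ ($0$ for $N<\ell(\lambda)$); it is stable under $x_{N+1}=0$ and $Q_\lambda(x|a)$ is the limit $N\to\infty$. The functions $\hat P_\lambda(y|a)$ ($\lambda$ strict), formal sums $\sum_k f_k(y)$ with $f_k$ a $\mathbb{C}[a]$-linear combination of Schur $Q$-functions of degree $k$ in $y$, are defined by $$\prod_{i,j}\frac{1+x_iy_j}{1-x_iy_j}=\sum_{\lambda\ \text{strict}}\hat P_\lambda(y|a)\,Q_\lambda(x|a).$$ *)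

(* Defs.v *)
From HB Require Import structures.
From mathcomp Require Import all_boot all_order all_algebra all_fingroup.
From mathcomp Require Import boolp.
From mathcomp Require Import zify.
From mathcomp Require Import finmap.
From mathcomp Require Import mpoly.
(* monalg is not imported: its notation {mpoly R[n]} clashes with mpoly's. *)
From mathcomp Require monalg.

Set Implicit Arguments.
Unset Strict Implicit.
Unset Printing Implicit Defensive.

Import Order.TTheory GRing.Theory Num.Theory.
Local Open Scope ring_scope.

(* - All indices are shifted by one: 'X_j : {mpoly K[n]} is a_(j+1), and the
     parameter sequences a : nat -> D start at a 0 = a_1.
   - Type C_r is treated for r = n.+1.  Simple reflections are numbered
     0, ..., n.+1 as usual; functions of such an index take it in nat and are
     only meaningful for values <= n.+1. *)

(* The element satisfying P if there is one, x0 otherwise. *)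
Definition the (T : Type) (x0 : T) (P : T -> Prop) : T :=
  if pselect (exists x, P x) is left ex then projT1 (cid ex) else x0.

Lemma theP (T : Type) (x0 : T) (P : T -> Prop) :
  (exists x, P x) -> P (the x0 P).
Proof. by move=> ex; rewrite /the; case: pselect => // e; case: cid. Qed.

Section InfinitePolynomials.
Import monalg.
Import mpoly.
Local Notation mon := (monalg.cmonom nat).

(* Polynomials over R in countably many variables a_1, a_2, ...; they form
   an integral domain when R does. *)
Definition cpoly (R : comNzRingType) := {malg R[mon]}.
Local Open Scope fset_scope.

Section Eval.
Variables (S : comNzRingType) (v : nat -> S).

Definition cmon_eval (m : mon) : S := \prod_(i <- finsupp m) v i ^+ m i.

Lemma cmon_evalw (d : {fset nat}) (m : mon) : (finsupp m `<=` d)%fset ->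
  cmon_eval m = \prod_(i <- d) v i ^+ m i.
Proof.
move=> le; apply: big_fset_incl => // i _; rewrite memNfinsupp => /eqP ->.
by rewrite expr0.
Qed.

Lemma cmon_eval_mmorphism : mmorphism cmon_eval.
Proof.
split=> [m1 m2|]; last by rewrite /cmon_eval mdom1 big_seq_fset0.
rewrite (cmon_evalw (fsubsetUl (finsupp m1) (finsupp m2))).
rewrite (cmon_evalw (fsubsetUr (finsupp m1) (finsupp m2))).
rewrite /cmon_eval mdomD -big_split; apply: eq_bigr => i _.
by rewrite cmM exprD.
Qed.
HB.instance Definition _ :=
  isMultiplicative.Build mon S cmon_eval cmon_eval_mmorphism.
End Eval.

Section Comm.
Variable R : comNzRingType.
HB.instance Definition _ := GRing.ComAlgebra.on (cpoly R).

Definition avar (i : nat) : cpoly R := mkmalgU (ucm i) 1.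

(* Substitution a_i := v i, with f on the coefficients. *)
Definition asubst (S : comNzRingType) (f : {rmorphism R -> S}) (v : nat -> S) :
  cpoly R -> S := monalg.mmap f (cmon_eval v).
Fact asubst_zmod (S : comNzRingType) (f : {rmorphism R -> S}) v :
  zmod_morphism (asubst f v).
Proof. exact: raddfB. Qed.
Fact asubst_monoid (S : comNzRingType) (f : {rmorphism R -> S}) v :
  monoid_morphism (asubst f v).
Proof. by split; [exact: rmorph1 | exact: rmorphM]. Qed.
HB.instance Definition _ (S : comNzRingType) (f : {rmorphism R -> S}) v :=
  GRing.isZmodMorphism.Build (cpoly R) S (asubst f v) (asubst_zmod f v).
HB.instance Definition _ (S : comNzRingType) (f : {rmorphism R -> S}) v :=
  GRing.isMonoidMorphism.Build (cpoly R) S (asubst f v) (asubst_monoid f v).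

Lemma asubst_avar (S : comNzRingType) (f : {rmorphism R -> S}) (v : nat -> S) i :
  asubst f v (avar i) = v i.
Proof.
rewrite /asubst monalg.mmapU /= (rmorph1 f) mul1r /cmon_eval mdomU big_seq_fset1.
by rewrite cmUU expr1.
Qed.
End Comm.

Section Integral.
Variable R : idomainType.
Implicit Types p q : cpoly R.

Definition cpoly_unit : pred (cpoly R) := fun p => `[< exists q, q * p = 1 >].
Definition cpoly_inv p : cpoly R :=
  if pselect (exists q, q * p = 1) is left ex then projT1 (cid ex) else p.

Lemma cpoly_mulVr : {in cpoly_unit, left_inverse 1 cpoly_inv *%R}.
Proof.
move=> p /asboolP ex; rewrite /cpoly_inv; case: pselect => // e.
by case: cid.
Qed.
Lemma cpoly_unitP p q : q * p = 1 -> p \in cpoly_unit.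
Proof. by move=> qp; apply/asboolP; exists q. Qed.
Lemma cpoly_inv_out : {in [predC cpoly_unit], cpoly_inv =1 id}.
Proof.
move=> p /asboolP nex; rewrite /cpoly_inv; case: pselect => // e.
Qed.
HB.instance Definition _ := GRing.ComNzRing_hasMulInverse.Build (cpoly R)
  cpoly_mulVr cpoly_unitP cpoly_inv_out.

Section Truncate.
Variable N : nat.
Let X (i : nat) : mpoly.mpoly N R :=
  if insub i is Some j then mpoly.mpolyX R (mnm1 j) else 0.
Let res (m : mon) : multinom N := Multinom [tuple m (val i) | i < N].
Let small (m : mon) := all (fun i => i < N)%N (finsupp m).

Lemma eval_small m : small m -> cmon_eval X m = mpoly.mpolyX R (res m).
Proof.
move=> /allP sm.
rewrite (@cmon_evalw _ _ [fset val i | i in 'I_N]%fset).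
  rewrite big_imfset /=; last by move=> i j _ _; apply: val_inj.
  rewrite big_enum /= [RHS]mpolyXE_id; apply: eq_bigr => j _.
  by rewrite /X valK mnmE.
apply/fsubsetP => i /sm lt_i; apply/imfsetP.
by exists (Ordinal lt_i); rewrite ?inE.
Qed.

Lemma res_inj m1 m2 : small m1 -> small m2 -> (res m1 == res m2) = (m1 == m2).
Proof.
move=> /allP s1 /allP s2; apply/eqP/eqP => [/mnmP e|->] //.
apply/eqP/cmP => i; case: (ltnP i N) => [lt|ge].
  by have := e (Ordinal lt); rewrite !mnmE.
have out (m : mon) : {in finsupp m, forall i, i < N}%N -> m i = 0%N.
  by move=> sm; apply/eqP; rewrite -memNfinsupp; apply: contraL ge => /sm; rewrite -ltnNge.
by rewrite !out.
Qed.

Lemma trunc_coef p m : {in monalg.msupp p, forall k, small k} -> small m ->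
  mpoly.mcoeff (res m) (asubst (@mpolyC N R) X p) = monalg.mcoeff m p.
Proof.
move=> sp sm; rewrite /asubst /monalg.mmap raddf_sum /=.
rewrite big_seq (eq_bigr (fun k => monalg.mcoeff k p * (k == m)%:R)); last first.
  move=> k kp; rewrite mcoeffCM eval_small ?sp // mpoly.mcoeffX.
  by rewrite res_inj //; exact: sp.
rewrite -big_seq; have [mp|mp] := boolP (m \in monalg.msupp p).
  rewrite (big_fsetD1 m) //= eqxx mulr1 big_seq big1 ?addr0 // => k.
  by rewrite !inE => /andP[/negbTE -> _]; rewrite mulr0.
rewrite (monalg.mcoeff_outdom mp) big_seq big1 // => k kp.
by case: eqP => [e|_]; rewrite ?mulr0 //; rewrite e (negbTE mp) in kp.
Qed.
End Truncate.

Lemma cpoly_integral p q : p * q = 0 -> (p == 0) || (q == 0).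
Proof.
move=> pq0; apply/norP => -[p0 q0].
have /fset0Pn [k kp] : monalg.msupp p != fset0 by rewrite monalg.msupp_eq0.
have /fset0Pn [l lq] : monalg.msupp q != fset0 by rewrite monalg.msupp_eq0.
pose b (r : cpoly R) := (\max_(m <- monalg.msupp r) \max_(i <- finsupp m) i.+1)%N.
pose N := maxn (b p) (b q).
have small r m : (b r <= N)%N -> m \in monalg.msupp r ->
    all (fun i => i < N)%N (finsupp m).
  move=> le mr; apply/allP => i im; apply: leq_trans le.
  pose F (k : mon) := (\max_(i <- finsupp k) i.+1)%N.
  have im' : (i < F m)%N.
    have := @leq_bigmax_seq _ (enum_fset (finsupp m)) xpredT succn i im isT.
    by move=> H; exact: H.
  apply: (leq_trans im').
  have := @leq_bigmax_seq _ (enum_fset (monalg.msupp r)) xpredT F m mr isT.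
  by move=> H; exact: H.
have sp m : m \in monalg.msupp p -> all (fun i => i < N)%N (finsupp m).
  by apply: small; exact: leq_maxl.
have sq m : m \in monalg.msupp q -> all (fun i => i < N)%N (finsupp m).
  by apply: small; exact: leq_maxr.
have nz (r : cpoly R) (m : mon) : {in monalg.msupp r, forall k : mon, all (fun i => i < N)%N (finsupp k)} ->
    m \in monalg.msupp r ->
    asubst (@mpolyC N R) (fun i : nat =>
      if insub i is Some j then mpoly.mpolyX R (mnm1 j) else 0) r != 0.
  move=> sr mr; apply/eqP => e0.
  have := trunc_coef sr (sr _ mr); rewrite e0 mcoeff0 => /esym/eqP.
  by apply/negP; rewrite mcoeff_neq0.
have := congr1 (asubst (@mpolyC N R) (fun i : nat =>
      if insub i is Some j then mpoly.mpolyX R (mnm1 j) else 0)) pq0.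
rewrite rmorphM rmorph0 => /eqP; rewrite mulf_eq0.
by rewrite (negbTE (nz _ _ sp kp)) (negbTE (nz _ _ sq lq)).
Qed.
HB.instance Definition _ :=
  GRing.ComUnitRing_isIntegral.Build (cpoly R) cpoly_integral.
End Integral.
End InfinitePolynomials.

(* The signed permutation w of a_1, ..., a_n sending a_j to
   (-1) ^ (sp_neg w j) * a_(sp_perm w j).  The product v * w is v after w, whereas
   MathComp composes permutations from left to right. *)
Record sperm (n : nat) := SPerm { sp_neg : {ffun 'I_n -> bool}; sp_perm : 'S_n }.

Section SignedPermutations.
Variable n : nat.
Implicit Types w : sperm n.

Definition sperm_code w := (sp_neg w, sp_perm w).
Definition sperm_decode (x : {ffun 'I_n -> bool} * 'S_n) := SPerm x.1 x.2.
Lemma sperm_codeK : cancel sperm_code sperm_decode.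
Proof. by case. Qed.
HB.instance Definition _ := Finite.copy (sperm n) (can_type sperm_codeK).

Definition sp_one := @SPerm n [ffun=> false] 1%g.
Definition sp_mul v w := @SPerm n
  [ffun j => sp_neg w j (+) sp_neg v (sp_perm w j)] (sp_perm w * sp_perm v)%g.
Definition sp_inv w := @SPerm n
  [ffun j => sp_neg w ((sp_perm w)^-1%g j)] (sp_perm w)^-1%g.

Lemma sp_mulA : associative sp_mul.
Proof.
move=> u v w; rewrite /sp_mul /=; congr SPerm; last by rewrite mulgA.
by apply/ffunP=> j; rewrite !ffunE permM addbA.
Qed.
Lemma sp_mul1 : left_id sp_one sp_mul.
Proof.
move=> [e s]; rewrite /sp_mul /=; congr SPerm; last by rewrite mulg1.
by apply/ffunP=> j; rewrite !ffunE addbF.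
Qed.
Lemma sp_mulr1 : right_id sp_one sp_mul.
Proof.
move=> [e s]; rewrite /sp_mul /=; congr SPerm; last by rewrite mul1g.
by apply/ffunP=> j; rewrite !ffunE perm1.
Qed.
Lemma sp_mulV : left_inverse sp_one sp_inv sp_mul.
Proof.
move=> [e s]; rewrite /sp_mul /=; congr SPerm; last by rewrite mulgV.
by apply/ffunP=> j; rewrite !ffunE permK addbb.
Qed.
Lemma sp_mulrV : right_inverse sp_one sp_inv sp_mul.
Proof.
move=> [e s]; rewrite /sp_mul /=; congr SPerm; last by rewrite mulVg.
by apply/ffunP=> j; rewrite !ffunE addbb.
Qed.
HB.instance Definition _ := isGroup.Build (sperm n)
  sp_mulA sp_mul1 sp_mulr1 sp_mulV sp_mulrV.

(* Action on the coweight lattice in the basis (eps_j) dual to (a_j), so that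
   w eps_j = (-1) ^ (sp_neg w j) eps_(sp_perm w j). *)
Definition sp_cow w (mu : {ffun 'I_n -> int}) : {ffun 'I_n -> int} :=
  [ffun i => (-1) ^+ sp_neg w ((sp_perm w)^-1%g i)
             * mu ((sp_perm w)^-1%g i)].

Lemma sp_cow1 mu : sp_cow 1%g mu = mu.
Proof. by apply/ffunP=> i; rewrite !ffunE /= invg1 perm1 ?ffunE mul1r. Qed.
Lemma sp_cowM v w mu : sp_cow (v * w)%g mu = sp_cow v (sp_cow w mu).
Proof.
apply/ffunP=> i; rewrite !ffunE /= ?ffunE invMg permM permKV.
by rewrite addbC signr_addb mulrA.
Qed.
Lemma sp_cowD v : {morph sp_cow v : x y / x + y}.
Proof. by move=> x y; apply/ffunP=> i; rewrite !ffunE mulrDr. Qed.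
End SignedPermutations.

(* W |x Q^vee: Waf mu w stands for t_mu w. *)
Record waf (n : nat) := Waf { waf_tr : {ffun 'I_n -> int}; waf_fin : sperm n }.

Section AffineWeylGroup.
Variable n : nat.
Implicit Types x y : waf n.

Definition waf_code x := (waf_tr x, waf_fin x).
Definition waf_decode (c : {ffun 'I_n -> int} * sperm n) := Waf c.1 c.2.
Lemma waf_codeK : cancel waf_code waf_decode.
Proof. by case. Qed.
HB.instance Definition _ := Choice.copy (waf n) (can_type waf_codeK).

Definition waf_one := @Waf n 0 1%g.
Definition waf_mul x y := @Waf n
  (waf_tr x + sp_cow (waf_fin x) (waf_tr y)) (waf_fin x * waf_fin y)%g.
Definition waf_inv x := @Waf n
  (- sp_cow (waf_fin x)^-1%g (waf_tr x)) (waf_fin x)^-1%g.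

Lemma waf_mulA : associative waf_mul.
Proof.
by move=> x y z; rewrite /waf_mul /= sp_cowD sp_cowM addrA mulgA.
Qed.
Lemma sp_cow0 (v : sperm n) : sp_cow v 0 = 0.
Proof. by apply/ffunP=> i; rewrite !ffunE mulr0. Qed.
Lemma sp_cowN (v : sperm n) mu : sp_cow v (- mu) = - sp_cow v mu.
Proof. by apply/ffunP=> i; rewrite !ffunE mulrN. Qed.
Lemma waf_mul1 : left_id waf_one waf_mul.
Proof. by move=> [m u]; rewrite /waf_mul /= sp_cow1 add0r mul1g. Qed.
Lemma waf_mulr1 : right_id waf_one waf_mul.
Proof. by move=> [m u]; rewrite /waf_mul /= sp_cow0 addr0 mulg1. Qed.
Lemma waf_mulV : left_inverse waf_one waf_inv waf_mul.
Proof. by move=> [m u]; rewrite /waf_mul /= addNr mulVg. Qed.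
Lemma waf_mulrV : right_inverse waf_one waf_inv waf_mul.
Proof.
by move=> [m u]; rewrite /waf_mul /= sp_cowN -sp_cowM mulgV sp_cow1 subrr.
Qed.
HB.instance Definition _ := isGroup.Build (waf n)
  waf_mulA waf_mul1 waf_mulr1 waf_mulV waf_mulrV.
End AffineWeylGroup.

(* The signed permutation underlying s_i; for i = 0 it is s_theta, theta = 2 a_1. *)
Definition srefl n (i : nat) : sperm n.+1 :=
  if i == 0%N then SPerm [ffun j => j == ord0] 1%g
  else if i == n.+1 then SPerm [ffun j => j == ord_max] 1%g
  else SPerm [ffun=> false] (tperm (inord i.-1) (inord i)).

Definition sgen n (i : nat) : waf n.+1 :=
  Waf (if i == 0%N then [ffun j => (j == ord0)%:R] else 0) (srefl n i).

Definition wprod n (s : seq nat) : waf n.+1 := (\prod_(i <- s) sgen n i)%g.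

Definition has_word n (x : waf n.+1) (k : nat) : bool :=
  [exists t : k.-tuple 'I_n.+2, wprod n (map val t) == x].

Section Generation.
Variable n : nat.
Local Notation r := n.+1.
Let G (x : waf r) := exists s : seq 'I_r.+1, wprod n (map val s) = x.
Let emb (v : sperm r) : waf r := Waf 0 v.
Let prm (s : 'S_r) : sperm r := SPerm [ffun=> false] s.
Let tr (m : {ffun 'I_r -> int}) : waf r := Waf m 1%g.

Local Lemma embM u v : emb (u * v)%g = (emb u * emb v)%g.
Proof. by rewrite /emb; congr Waf; rewrite /= sp_cow0 addr0. Qed.
Local Lemma prmM u v : prm (u * v)%g = (prm v * prm u)%g.
Proof. by congr SPerm; apply/ffunP=> j; rewrite !ffunE. Qed.
Local Lemma trD m m' : tr (m + m') = (tr m * tr m')%g.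
Proof. by congr Waf; rewrite /= ?mulg1 ?sp_cow1. Qed.
Local Lemma GM x y : G x -> G y -> G (x * y)%g.
Proof.
move=> [s <-] [t <-]; exists (s ++ t).
by rewrite /wprod map_cat big_cat.
Qed.
Local Lemma G1 : G 1%g.
Proof. by exists [::]; rewrite /wprod big_nil. Qed.
Local Lemma Ggen i : (i <= r)%N -> G (sgen n i).
Proof.
move=> le_ir; exists [:: inord i]; rewrite /wprod /= big_cons big_nil mulg1.
by rewrite inordK.
Qed.
Local Lemma Gadj i : (i < n)%N -> G (emb (prm (tperm (inord i) (inord i.+1)))).
Proof.
move=> lt_in; have := @Ggen i.+1 (leqW lt_in); rewrite /sgen /= /srefl /=.
by rewrite eqSS (ltn_eqF lt_in).
Qed.
Local Lemma Gtp i j : (i < j)%N -> (j <= n)%N ->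
  G (emb (prm (tperm (inord i) (inord j)))).
Proof.
elim: j => // j IH; rewrite ltnS leq_eqVlt => /orP[/eqP <-|ltij] lejn.
  exact: Gadj.
have -> : tperm (inord i) (inord j.+1) =
    (tperm (inord j) (inord j.+1) * (tperm (inord i) (inord j) *
     tperm (inord j) (inord j.+1)))%g :> 'S_r.
  rewrite -[X in (X * _)%g]tpermV -conjgE tpermJ tpermL tpermD //.
    by apply/eqP=> /(congr1 val); rewrite /= !inordK; lia.
  by apply/eqP=> /(congr1 val); rewrite /= !inordK; lia.
by rewrite !prmM !embM; do 2?apply: GM; (apply: Gadj || apply: IH)=> //; lia.
Qed.
Local Lemma Gtperm i j : G (emb (prm (tperm i j))).
Proof.
wlog: i j / (i <= j)%N => [H|].
  by case: (leqP i j) => [/H//|/ltnW/H]; rewrite tpermC.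
rewrite leq_eqVlt => /orP[/eqP/val_inj<-|lt].
  rewrite tperm1 (_ : emb _ = 1%g) //; exact: G1.
by have := Gtp lt (leq_ord j); rewrite !inord_val.
Qed.
Local Lemma Gperm s : G (emb (prm s)).
Proof.
have [ts -> _] := prod_tpermP s.
elim: ts => [|t ts IH]; first by rewrite big_nil; exact: G1.
by rewrite big_cons prmM embM; apply: GM => //; exact: Gtperm.
Qed.
Let neg (e : {ffun 'I_r -> bool}) : sperm r := SPerm e 1%g.
Local Lemma Gneg1 j : G (emb (neg [ffun k => k == j])).
Proof.
have -> : neg [ffun k => k == j] =
    (prm (tperm j ord_max) * (srefl n r * prm (tperm j ord_max)))%g.
  rewrite /srefl eqxx /=; congr SPerm; last by rewrite /= mulg1 tperm2.
  apply/ffunP=> k; rewrite !ffunE /= addbF.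
  by rewrite -(inj_eq (@perm_inj _ (tperm j ord_max))) tpermL.
rewrite !embM; do 2?apply: GM; try exact: Gperm.
by have := Ggen (leqnn r).
Qed.
Local Lemma Gneg e : G (emb (neg e)).
Proof.
have [m] := ubnP #|[pred j | e j]|; elim: m e => // m IH e le_e.
have [/existsP[j ej]|/existsPn ne] := boolP [exists j, e j]; last first.
  rewrite (_ : emb _ = 1%g); first exact: G1.
  by congr Waf; congr SPerm; apply/ffunP=> j; rewrite ffunE; apply/negbTE.
pose e' := [ffun k => (k != j) && e k].
have -> : neg e = (neg e' * neg [ffun k => k == j])%g.
  congr SPerm; last by rewrite mulg1.
  apply/ffunP=> k; rewrite !ffunE perm1; case: eqVneq => [->|] //=.
rewrite embM; apply: GM; last exact: Gneg1.
apply: IH; rewrite (cardD1 j) inE ej add1n ltnS in le_e.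
apply: leq_ltn_trans le_e; rewrite subset_leq_card //.
by apply/subsetP=> k; rewrite !inE /= ffunE.
Qed.
Local Lemma Gemb v : G (emb v).
Proof.
case: v => e s; have -> : SPerm e s = (prm s * neg e)%g.
  congr SPerm; last by rewrite mul1g.
  by apply/ffunP=> j; rewrite !ffunE addbF.
by rewrite embM; apply: GM; [exact: Gperm | exact: Gneg].
Qed.
Local Lemma Gconj m v : G (tr m) -> G (tr (sp_cow v m)).
Proof.
move=> Gm; have -> : tr (sp_cow v m) = (emb v * (tr m * emb v^-1))%g.
  by congr Waf; rewrite /= ?mul1g ?mulgV // add0r sp_cow0 addr0.
by do 2?apply: GM => //; exact: Gemb.
Qed.
Let eps j : {ffun 'I_r -> int} := [ffun k => (k == j)%:R].
Local Lemma Geps j : G (tr (eps j)).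
Proof.
suff: G (tr (eps ord0)).
  move/(@Gconj _ (prm (tperm ord0 j))); congr (G (tr _)).
  apply/ffunP=> k; rewrite !ffunE mul1r tpermV.
  by rewrite -[in RHS](inj_eq (@perm_inj _ (tperm ord0 j))) tpermR.
have -> : tr (eps ord0) = (sgen n 0 * emb (srefl n 0))%g.
  congr Waf; first by rewrite /= sp_cow0 addr0.
  congr SPerm; last by rewrite mulg1.
  by apply/ffunP=> k; rewrite !ffunE perm1 addbb.
by apply: GM; [exact: Ggen | exact: Gemb].
Qed.
Local Lemma GepsN j : G (tr (- eps j)).
Proof.
have /(@Gconj _ (neg [ffun k => k == j])) := Geps j; congr (G (tr _)).
by apply/ffunP=> k; rewrite !ffunE invg1 perm1; case: eqP.
Qed.
Local Lemma Gtr m : G (tr m).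
Proof.
have Gnat c k : G (tr c) -> G (tr (c *+ k)).
  move=> Gc; elim: k => [|k IH]; first by rewrite mulr0n; exact: G1.
  by rewrite mulrS trD; exact: GM.
have Gz (z : int) j : G (tr (eps j *~ z)).
  case: z => k; first exact: Gnat (Geps j).
  by rewrite NegzE mulrNz -mulNrz; exact: Gnat (GepsN j).
have -> : m = \sum_j eps j *~ m j.
  apply/ffunP=> k; rewrite sum_ffunE (bigD1 k) //= big1 => [|j ne].
    by rewrite addr0 ffunMzE ffunE eqxx -mulrzl intz mulr1.
  by rewrite ffunMzE ffunE eq_sym (negbTE ne) mul0rz.
elim/big_rec: _ => [|j x _ IH]; first exact: G1.
by rewrite trD; apply: GM.
Qed.
Lemma waf_gen (x : waf r) : exists k, has_word x k.
Proof.
suff [s <-] : G x.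
  by exists (size s); apply/existsP; exists (in_tuple s) => /=.
case: x => m v; have -> : Waf m v = (tr m * emb v)%g.
  by congr Waf; rewrite /= ?mul1g // sp_cow0 addr0.
by apply: GM; [exact: Gtr | exact: Gemb].
Qed.
End Generation.

(* Coxeter length with respect to s_0, ..., s_(n+1). *)
Definition wlen n (x : waf n.+1) : nat := ex_minn (waf_gen x).

Lemma wlenP n (x : waf n.+1) : has_word x (wlen x).
Proof. by rewrite /wlen; case: ex_minnP. Qed.

(* Some reduced word of x. *)
Definition redword n (x : waf n.+1) : seq nat :=
  map val (xchoose (existsP (wlenP x))).

Section Restriction.
Variables (R : comNzRingType) (N : nat).

(* Setting the last variable y_(N+1) to 0. *)
Definition yrestr (p : {mpoly R[N.+1]}) : {mpoly R[N]} :=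
  p \mPo [tuple oapp (fun j : 'I_N => 'X_j) 0 (unlift ord_max i) | i < N.+1].
Fact yrestr_zmod : zmod_morphism yrestr.
Proof. exact: raddfB. Qed.
Fact yrestr_monoid : monoid_morphism yrestr.
Proof. by split; [exact: rmorph1 | exact: rmorphM]. Qed.
HB.instance Definition _ :=
  GRing.isZmodMorphism.Build {mpoly R[N.+1]} {mpoly R[N]} yrestr yrestr_zmod.
HB.instance Definition _ :=
  GRing.isMonoidMorphism.Build {mpoly R[N.+1]} {mpoly R[N]} yrestr yrestr_monoid.

Lemma yrestrZ c p : yrestr (c *: p) = c *: yrestr p.
Proof. exact: comp_mpolyZ. Qed.

Lemma yrestr_widen (j : 'I_N) : yrestr 'X_(widen_ord (leqnSn N) j) = 'X_j.
Proof.
rewrite /yrestr comp_mpolyXU -tnth_nth tnth_mktuple.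
suff -> : widen_ord (leqnSn N) j = lift ord_max j by rewrite liftK.
by apply: val_inj; rewrite /= /bump leqNgt ltn_ord.
Qed.

Lemma yrestr_max : yrestr 'X_ord_max = 0.
Proof. by rewrite /yrestr comp_mpolyXU -tnth_nth tnth_mktuple unlift_none. Qed.

Lemma mcoeff_yrestr p m : (yrestr p)@_m = p@_(mnmwiden m).
Proof.
elim/mpolyind: p => [|c m' p _ _ IH]; first by rewrite rmorph0 !mcoeff0.
rewrite rmorphD /= yrestrZ !mcoeffD !mcoeffZ {}IH; congr (_ * _ + _).
rewrite mcoeffX [in LHS]mpolyXE_id rmorph_prod big_ord_recr /= rmorphXn /=.
rewrite yrestr_max (eq_bigr (fun j : 'I_N => 'X_j ^+ m' (widen_ord (leqnSn N) j)));
  last by move=> j _; rewrite rmorphXn /= yrestr_widen.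
pose mm := [multinom m' (widen_ord (leqnSn N) j) | j < N].
have -> : \prod_(j < N) 'X_j ^+ m' (widen_ord (leqnSn N) j) = 'X_[R, mm].
  by rewrite [RHS]mpolyXE_id; apply: eq_bigr => j _; rewrite mnmE.
have wE k j : mnmwiden k (widen_ord (leqnSn N) j) = k j by exact: mnmwiden_widen.
have w0 k : mnmwiden k ord_max = 0%N by exact: mnmwiden_ordmax.
rewrite expr0n; case: eqP => m0 /=; rewrite ?mulr1 ?mulr0 ?mcoeff0 ?mcoeffX.
  congr (_ : bool)%:R; apply/eqP/eqP=> [<-|m'E].
    apply/mnmP=> i; case: (unliftP ord_max i) => [j|] ->.
      rewrite (_ : lift _ _ = widen_ord (leqnSn N) j) ?wE ?mnmE //.
      by apply: val_inj; rewrite /= /bump leqNgt ltn_ord.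
    by rewrite w0.
  by apply/mnmP=> j; rewrite mnmE m'E wE.
by case: eqP => // mE; case: m0; rewrite mE w0.
Qed.
End Restriction.

Section Lambda.
Variable R : comNzRingType.

(* Formal sums f_0 + f_1 + ... with f_k a symmetric function of degree k in
   y_1, y_2, ... over R; with R = S this is hat-Lambda_S.  As usual a symmetric
   function is given by its values f_k(y_1, ..., y_N), that is f k N, which must
   be compatible under y_(N+1) = 0. *)
Record hLambda := HLambda {
  hcomp :> forall k N : nat, {mpoly R[N]};
  hcomp_sym : forall k N, hcomp k N \is symmetric;
  hcomp_homog : forall k N, hcomp k N \is k.-homog;
  hcomp_restr : forall k N, yrestr (hcomp k N.+1) = hcomp k N }.

HB.instance Definition _ := gen_eqMixin hLambda.
HB.instance Definition _ := gen_choiceMixin hLambda.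

Lemma hLambdaP (f g : hLambda) : (forall k N, f k N = g k N) -> f = g.
Proof.
case: f g => [f f1 f2 f3] [g g1 g2 g3] /= fg.
have eq_fg : f = g by apply/functional_extensionality_dep=> k;
  apply/functional_extensionality_dep=> N; exact: fg.
by case: g / eq_fg g1 g2 g3 fg => *; congr HLambda; exact: Prop_irrelevance.
Qed.

Implicit Types f g h : hLambda.

Program Definition hzero := @HLambda (fun k N => 0) _ _ _.
Next Obligation. exact: rpred0. Qed.
Next Obligation. exact: rpred0. Qed.
Next Obligation. exact: rmorph0. Qed.

Program Definition hopp f := @HLambda (fun k N => - f k N) _ _ _.
Next Obligation. by rewrite rpredN hcomp_sym. Qed.
Next Obligation. by rewrite rpredN hcomp_homog. Qed.
Next Obligation. by rewrite rmorphN /= hcomp_restr. Qed.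

Program Definition hadd f g := @HLambda (fun k N => f k N + g k N) _ _ _.
Next Obligation. by rewrite rpredD ?hcomp_sym. Qed.
Next Obligation. by rewrite rpredD ?hcomp_homog. Qed.
Next Obligation. by rewrite rmorphD /= !hcomp_restr. Qed.

Program Definition hscale (c : R) f := @HLambda (fun k N => c *: f k N) _ _ _.
Next Obligation. by rewrite rpredZ ?hcomp_sym. Qed.
Next Obligation. by rewrite rpredZ ?hcomp_homog. Qed.
Next Obligation. by rewrite yrestrZ hcomp_restr. Qed.

Program Definition hone := @HLambda (fun k N => (k == 0%N)%:R) _ _ _.
Next Obligation. exact: rpred_nat. Qed.
Next Obligation. by case: k => [|k]; [exact: dhomog1 | exact: rpred0]. Qed.
Next Obligation. exact: rmorph_nat. Qed.

Program Definition hmul f g :=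
  @HLambda (fun k N => \sum_(i < k.+1) f i N * g (k - i)%N N) _ _ _.
Next Obligation. by apply: rpred_sum => i _; rewrite rpredM ?hcomp_sym. Qed.
Next Obligation.
apply: rpred_sum => i _.
have := dhomogM (hcomp_homog f i N) (hcomp_homog g (k - i) N).
by rewrite subnKC ?leq_ord.
Qed.
Next Obligation.
rewrite rmorph_sum; apply: eq_bigr => i _.
by rewrite rmorphM /= !hcomp_restr.
Qed.

Lemma haddA : associative hadd.
Proof. by move=> f g h; apply: hLambdaP => k N /=; rewrite addrA. Qed.
Lemma haddC : commutative hadd.
Proof. by move=> f g; apply: hLambdaP => k N /=; rewrite addrC. Qed.
Lemma hadd0 : left_id hzero hadd.
Proof. by move=> f; apply: hLambdaP => k N /=; rewrite add0r. Qed.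
Lemma haddN : left_inverse hzero hopp hadd.
Proof. by move=> f; apply: hLambdaP => k N /=; rewrite addNr. Qed.
HB.instance Definition _ := GRing.isZmodule.Build hLambda haddA haddC hadd0 haddN.

Lemma hcompM_poly f g k N m : (k <= m)%N -> (hmul f g) k N =
  ((\poly_(i < m.+1) f i N) * (\poly_(i < m.+1) g i N))`_k.
Proof.
move=> le_km; rewrite coefM; apply: eq_bigr => i _.
by rewrite !coef_poly !ifT //; have := ltn_ord i; lia.
Qed.

Lemma hmulC : commutative hmul.
Proof.
by move=> f g; apply: hLambdaP => k N; rewrite !(hcompM_poly _ _ _ (leqnn k)) mulrC.
Qed.
Lemma hmulA : associative hmul.
Proof.
move=> f g h; apply: hLambdaP => k N.
transitivity ((\poly_(i < k.+1) f i N * (\poly_(i < k.+1) g i N *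
  \poly_(i < k.+1) h i N))`_k).
  rewrite coefM; apply: eq_bigr => i _.
  rewrite coef_poly ltn_ord; congr (_ * _); apply: hcompM_poly; exact: leq_subr.
rewrite mulrA coefM; apply: eq_bigr => i _.
rewrite -(hcompM_poly _ _ _ (leq_ord i)) coef_poly ifT //.
by rewrite ltnS leq_subr.
Qed.
Lemma hmul1 : left_id hone hmul.
Proof.
move=> f; apply: hLambdaP => k N /=.
rewrite big_ord_recl /= mul1r subn0 big1 ?addr0 // => i _.
by rewrite mul0r.
Qed.
Lemma hmulD : left_distributive hmul hadd.
Proof.
move=> f g h; apply: hLambdaP => k N /=.
by rewrite -big_split; apply: eq_bigr => i _; rewrite mulrDl.
Qed.
Lemma hone_neq0 : hone != hzero.
Proof.
apply/eqP=> /(congr1 (fun f : hLambda => f 0%N 0%N)) /eqP.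
by rewrite /= oner_eq0.
Qed.
HB.instance Definition _ :=
  GRing.Zmodule_isComNzRing.Build hLambda hmulA hmulC hmul1 hmulD hone_neq0.

Lemma hscaleA a b f : hscale a (hscale b f) = hscale (a * b) f.
Proof. by apply: hLambdaP => k N /=; rewrite scalerA. Qed.
Lemma hscale1 : left_id 1 hscale.
Proof. by move=> f; apply: hLambdaP => k N /=; rewrite scale1r. Qed.
Lemma hscaleDr : right_distributive hscale +%R.
Proof. by move=> a f g; apply: hLambdaP => k N /=; rewrite scalerDr. Qed.
Lemma hscaleDl f : {morph hscale^~ f : a b / a + b}.
Proof. by move=> a b; apply: hLambdaP => k N /=; rewrite scalerDl. Qed.
HB.instance Definition _ := GRing.Zmodule_isLmodule.Build R hLambda
  hscaleA hscale1 hscaleDr hscaleDl.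

Lemma mcoeff_pihomog N k (p : {mpoly R[N]}) m :
  (pihomog mdeg k p)@_m = if mdeg m == k then p@_m else 0.
Proof.
elim/mpolyind: p => [|c m' p _ _ IH]; first by rewrite linear0 mcoeff0 if_same.
rewrite linearD linearZ /= pihomogX !mcoeffD !mcoeffZ {}IH.
case: (m' =P m) => [->|ne]; first by case: ifP; rewrite ?mcoeff0 ?mulr0 ?addr0.
rewrite [in RHS]mcoeffX (introF eqP ne) mulr0 add0r.
case: (mdeg m' == k); last by rewrite mcoeff0 mulr0 add0r.
by rewrite mcoeffX (introF eqP ne) mulr0 add0r.
Qed.

(* Omega(u|y) is the product of the series (1 + u y_j) (sum_r (u y_j)^r); in
   degree k the terms with r > k do not contribute, hence the truncation. *)
Definition omega_trunc (u : R) d N : {mpoly R[N]} :=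
  \prod_(j < N) ((1 + u *: 'X_j) * \sum_(r < d.+1) (u *: 'X_j) ^+ r).

Program Definition omega (u : R) :=
  @HLambda (fun k N => pihomog mdeg k (omega_trunc u k N)) _ _ _.
Next Obligation.
apply/issymP => s; apply/mpolyP => m; rewrite mcoeff_sym !mcoeff_pihomog.
have -> : mdeg [multinom m (s i) | i < N] = mdeg m.
  by rewrite !mdegE [RHS](reindex_inj (@perm_inj _ s)); apply: eq_bigr => i _;
    rewrite mnmE.
rewrite -mcoeff_sym; congr (if _ then _@_m else _).
rewrite rmorph_prod [RHS](reindex_inj (@perm_inj _ s)); apply: eq_bigr => j _.
have sX : msym s (u *: 'X_j) = u *: 'X_(s j).
  rewrite linearZ /= msymX; congr (_ *: 'X_[_]).
  by apply/mnmP => i; rewrite !mnmE -(inj_eq (@perm_inj _ s)) permKV.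
rewrite rmorphM rmorphD rmorph1 rmorph_sum /= sX; congr (_ * _).
by apply: eq_bigr => r _; rewrite rmorphXn /= sX.
Qed.
Next Obligation. exact: pihomogP. Qed.
Next Obligation.
apply/mpolyP => m; rewrite mcoeff_yrestr !mcoeff_pihomog.
have -> : mdeg (mnmwiden m) = mdeg m.
  rewrite !mdegE big_ord_recr /= mnmwiden_ordmax addn0.
  by apply: eq_bigr => i _; rewrite mnmwiden_widen.
rewrite -mcoeff_yrestr; congr (if _ then _@_m else _).
rewrite rmorph_prod big_ord_recr /=.
rewrite [X in _ * X](_ : _ = 1) ?mulr1; last first.
  rewrite rmorphM rmorphD rmorph1 rmorph_sum /= yrestrZ yrestr_max scaler0.
  rewrite addr0 mul1r big_ord_recl rmorphXn expr0 big1 ?addr0 // => i _.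
  by rewrite rmorphXn /= yrestrZ yrestr_max scaler0 expr0n.
apply: eq_bigr => j _; rewrite rmorphM rmorphD rmorph1 rmorph_sum /=.
rewrite yrestrZ yrestr_widen; congr (_ * _).
by apply: eq_bigr => r _; rewrite rmorphXn /= yrestrZ yrestr_widen.
Qed.
End Lambda.

Section CoefficientMap.
Variables (R R' : comNzRingType) (phi : {rmorphism R -> R'}).

Program Definition hmap (f : hLambda R) : hLambda R' :=
  @HLambda _ (fun k N => map_mpoly phi (f k N)) _ _ _.
Next Obligation.
apply/issymP => s; apply/mpolyP => m; rewrite mcoeff_sym !mcoeff_map_mpoly.
by rewrite -mcoeff_sym (issymP _ (hcomp_sym f k N)).
Qed.
Next Obligation.
apply/dhomogP => m; rewrite mcoeff_msupp mcoeff_map_mpoly => nz.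
have /dhomogP hf := hcomp_homog f k N; apply: hf; rewrite mcoeff_msupp.
by apply/eqP => e0; move: nz; rewrite e0 raddf0 eqxx.
Qed.
Next Obligation.
apply/mpolyP => m; rewrite mcoeff_yrestr !mcoeff_map_mpoly -mcoeff_yrestr.
by rewrite hcomp_restr.
Qed.
End CoefficientMap.

Section DualAffineP.
Variables (K : numFieldType) (n : nat).
Local Notation S := {mpoly K[n.+1]}.

(* Ring automorphism of S = K[a_1, ..., a_(n+1)] extending the signed
   permutation of the variables. *)
Definition sp_act (w : sperm n.+1) : S -> S := comp_mpoly
  [tuple (-1) ^+ sp_neg w j *: 'X_(sp_perm w j) | j < n.+1].
Fact sp_act_zmod w : zmod_morphism (sp_act w).
Proof. exact: raddfB. Qed.
Fact sp_act_monoid w : monoid_morphism (sp_act w).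
Proof. by split; [exact: rmorph1 | exact: rmorphM]. Qed.
HB.instance Definition _ w :=
  GRing.isZmodMorphism.Build S S (sp_act w) (sp_act_zmod w).
HB.instance Definition _ w :=
  GRing.isMonoidMorphism.Build S S (sp_act w) (sp_act_monoid w).

Definition alpha (i : nat) : S :=
  if i == 0%N then - (2 *: 'X_ord0)
  else if i == n.+1 then 2 *: 'X_ord_max
  else 'X_(inord i.-1) - 'X_(inord i).

Definition sact (i : nat) (f : hLambda S) : hLambda S :=
  if i == 0%N then omega ('X_ord0 : S) * hmap (sp_act (srefl n 0)) f
  else hmap (sp_act (srefl n i)) f.

(* A_i f is the quotient of f - s_i f by alpha_i, which exists (divdiffP) and is
   unique since S is a domain. *)
Definition divdiff (i : nat) (f : hLambda S) : hLambda S :=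
  the 0 (fun g => alpha i *: g = f - sact i f).

Lemma sp_actXU w j : sp_act w 'X_j = (-1) ^+ sp_neg w j *: 'X_(sp_perm w j).
Proof. by rewrite /sp_act comp_mpolyXU -tnth_nth tnth_mktuple. Qed.

Lemma sp_actZ w c p : sp_act w (c *: p) = c *: sp_act w p.
Proof. exact: comp_mpolyZ. Qed.

Lemma sp_act_dvd w (al : S) :
  (forall j, exists q, 'X_j - sp_act w 'X_j = al * q) ->
  forall p, exists q, p - sp_act w p = al * q.
Proof.
move=> X p.
have M u v : (exists q, u - sp_act w u = al * q) ->
    (exists q, v - sp_act w v = al * q) ->
    exists q, u * v - sp_act w (u * v) = al * q.
  move=> [q eq] [q' eq']; exists (q * v + sp_act w u * q').
  rewrite mulrDr mulrA -eq mulrCA -eq' rmorphM /= mulrBl mulrBr.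
  by rewrite addrA subrK.
have one : exists q, 1 - sp_act w 1 = al * q.
  by exists 0; rewrite rmorph1 subrr mulr0.
elim/mpolyind: p => [|c m p _ _ [q' IH]].
  by exists 0; rewrite rmorph0 subrr mulr0.
have [q eq] : exists q, 'X_[m] - sp_act w 'X_[m] = al * q.
  rewrite mpolyXE_id; elim/big_ind: _ => // j _.
  by elim: (m j) => [|k IHk] //; rewrite exprS; apply: M.
exists (c *: q + q'); rewrite rmorphD /= sp_actZ opprD addrACA IH -scalerBr eq.
by rewrite mulrDr -scalerAr.
Qed.

Lemma alpha_neq0 i : (i <= n.+1)%N -> alpha i != 0.
Proof.
move=> le_i; rewrite /alpha; have nX (j : 'I_n.+1) : ('X_j : S) != 0.
  by rewrite -msize_poly_eq0 msizeX.
case: ifP => [_|i0]; first by rewrite oppr_eq0 scaler_eq0 negb_or nX pnatr_eq0.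
case: ifP => [_|ir]; first by rewrite scaler_eq0 negb_or nX pnatr_eq0.
rewrite subr_eq0; apply/eqP => /mpolyP /(_ U_(inord i)%MM).
rewrite !mcoeffX eqxx; case: eqP => [|_]; last by move/eqP; rewrite eq_sym oner_eq0.
move=> /mnmP /(_ (inord i)) + _; rewrite !mnmE eqxx.
case: eqP => // /(congr1 val); rewrite /= !inordK; lia.
Qed.

Lemma refl_dvd i p : (i <= n.+1)%N -> exists q, p - sp_act (srefl n i) p = alpha i * q.
Proof.
move=> le_i; apply: sp_act_dvd => {p} j; rewrite sp_actXU /srefl /alpha.
have [_|/eqP i0] := eqVneq i 0%N.
  rewrite /= ffunE perm1; case: eqVneq => [->|_] /=; last first.
    by exists 0; rewrite scale1r subrr mulr0.
  exists (- 1); rewrite mulrN1 opprK expr1 scaleN1r opprK.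
  by rewrite scaler_nat mulr2n.
have [_|/eqP ir] := eqVneq i n.+1.
  rewrite /= ffunE perm1; case: eqVneq => [->|_] /=; last first.
    by exists 0; rewrite scale1r subrr mulr0.
  by exists 1; rewrite mulr1 expr1 scaleN1r opprK scaler_nat mulr2n.
rewrite /= ffunE scale1r; case: tpermP => [->|->|_ _].
- by exists 1; rewrite mulr1.
- by exists (- 1); rewrite mulrN1 opprB.
- by exists 0; rewrite subrr mulr0.
Qed.

Definition hdvd (al : S) (h : hLambda S) :=
  forall k N, exists q : {mpoly S[N]}, h k N = al *: q.

Lemma hdvdD al f g : hdvd al f -> hdvd al g -> hdvd al (f + g).
Proof.
move=> F G k N; have [q e] := F k N; have [q' e'] := G k N.
by exists (q + q'); rewrite scalerDr -e -e'.
Qed.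
Lemma hdvdM al f g : hdvd al f -> hdvd al (f * g).
Proof.
move=> F k N; suff [q e] : exists q : {mpoly S[N]},
    \sum_(i < k.+1) f i N * g (k - i)%N N = al *: q by exists q.
elim/big_ind: _ => [|x y [q ->] [q' ->]|i _].
- by exists 0; rewrite scaler0.
- by exists (q + q'); rewrite scalerDr.
- by have [q ->] := F i N; exists (q * g (k - i)%N N); rewrite scalerAl.
Qed.
Lemma hdvd_coef (al : S) (h : hLambda S) :
  (forall k N m, exists c : S, (h k N)@_m = al * c) -> hdvd al h.
Proof.
move=> H k N; exists (\sum_(m <- msupp (h k N)) projT1 (cid (H k N m)) *: 'X_[m]).
rewrite {1}[h k N]mpolyE scaler_sumr; apply: eq_bigr => m _.
by case: cid => c /= ->; rewrite scalerA.
Qed.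
Lemma hdvdE (al : S) (h : hLambda S) : al != 0 -> hdvd al h -> exists g, al *: g = h.
Proof.
move=> al0 H; pose g k N := projT1 (cid (H k N)).
have gE k N : h k N = al *: g k N by rewrite /g; case: cid.
have canc N : injective (fun p : {mpoly S[N]} => al *: p).
  by move=> p q; rewrite /= -!mul_mpolyC; apply: mulfI; rewrite mpolyC_eq0.
have gs k N : g k N \is symmetric.
  apply/issymP => s; apply: (canc N); rewrite /= -gE -msymZ -gE.
  exact/issymP/hcomp_sym.
have gh k N : g k N \is k.-homog.
  have /dhomogP hh := hcomp_homog h k N; apply/dhomogP => m.
  rewrite mcoeff_msupp => nz; apply: hh.
  by rewrite mcoeff_msupp gE mcoeffZ mulf_neq0.
have gr k N : yrestr (g k N.+1) = g k N.
  by apply: (canc N); rewrite /= -yrestrZ -!gE hcomp_restr.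
by exists (HLambda gs gh gr); apply: hLambdaP => k N; rewrite gE.
Qed.
Lemma omega_dvd u : hdvd u (omega u - 1).
Proof.
move=> k N; have [q e] : exists q, omega_trunc u k N = 1 + u *: q.
  rewrite /omega_trunc; elim/big_ind: _ => [|x y [q ->] [q' ->]|j _].
  - by exists 0; rewrite scaler0 addr0.
  - exists (q + (1 + u *: q) * q').
    by rewrite mulrDr mulr1 scalerDr addrA -scalerAr.
  - rewrite big_ord_recl expr0 (eq_bigr (fun r : 'I_k => u *: ('X_j * (u *: 'X_j) ^+ r))).
      rewrite -scaler_sumr mulrDl mul1r mulrDr mulr1 -scalerAl.
      by eexists; rewrite -addrA -!scalerDr.
    by move=> r _; rewrite /= exprS -scalerAl.
exists (pihomog mdeg k q).
have -> : (omega u - 1 : hLambda S) k N = pihomog mdeg k (omega_trunc u k N) - (k == 0%N)%:R by [].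
rewrite e linearD linearZ /= addrAC [X in X - _](_ : _ = (k == 0%N)%:R) ?subrr ?add0r //.
case: k {e} => [|k]; first by rewrite pihomog_dE ?dhomog1.
by rewrite (@pihomog_ne0 _ _ _ 0) ?dhomog1.
Qed.

Lemma divdiffP i f : (i <= n.+1)%N -> alpha i *: divdiff i f = f - sact i f.
Proof.
move=> le_i; apply: (@theP _ 0 (fun g => alpha i *: g = f - sact i f)).
apply: hdvdE (alpha_neq0 le_i) _.
have D : hdvd (alpha i) (f - hmap (sp_act (srefl n i)) f).
  apply: hdvd_coef => k N m; rewrite mcoeffB mcoeff_map_mpoly.
  exact: refl_dvd.
rewrite /sact; case: eqP => [i0|//]; move: D; rewrite i0; set g := hmap _ f => D.
have -> : f - omega ('X_ord0 : S) * g = (f - g) + (omega ('X_ord0 : S) - 1) * (- g).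
  by rewrite mulrN mulrBl mul1r opprB addrA subrK.
apply: hdvdD => //; apply: hdvdM => k N.
have [q ->] := omega_dvd 'X_ord0 k N; exists ((- (2^-1 : K))%:MP *: q).
rewrite scalerA; congr (_ *: _); rewrite /alpha /= mulNr.
by rewrite rmorphN mulrN opprK mulrC mul_mpolyC scalerA mulVf ?scale1r // pnatr_eq0.
Qed.

(* A_w 1, computed along a reduced word of w; by the braid relations the choice
   of the word is immaterial. *)
Definition Paff (w : waf n.+1) : hLambda S := foldr divdiff 1 (redword w).
End DualAffineP.

Section Partitions.
Variable n : nat.
Local Notation r := n.+1.

Definition strict_part (la : seq nat) : bool := sorted gtn la && (0%N \notin la).

(* The set P_C of partitions, as nonincreasing lists of positive parts. *)
Definition partC (la : seq nat) : bool :=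
  [&& sorted geq la, all (fun k => 0 < k <= r.*2)%N la
    & all (fun k => count_mem k la <= 1)%N (iota 1 r)].

(* The word of the element rho_i. *)
Definition rho (i : nat) : seq nat :=
  if (i <= r)%N then rev (iota 0 i)
  else iota (r.*2.+1 - i) (i - r.+1) ++ rev (iota 0 r.+1).

(* The inverse of la |-> rho_(la_l) ... rho_(la_1). *)
Definition lambda_of (w : waf r) : seq nat :=
  the [::] (fun la => partC la /\ wprod n (flatten (rev (map rho la))) = w).

(* w has minimal length in its coset w W. *)
Definition min_coset_rep (w : waf r) : bool :=
  [forall v : sperm r, wlen w <= wlen (w * Waf 0%R v)%g]%N.
End Partitions.

Section FactorialQ.
Variables (D : idomainType) (a : nat -> D) (la : seq nat) (N : nat).
Local Notation F := {fraction {mpoly D[N]}}.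
Let x (i : 'I_N) : F := FracField.tofrac ('X_i : {mpoly D[N]}).
Let ffact (z : F) (k : nat) : F :=
  2 * z * \prod_(i < k.-1) (z - FracField.tofrac ((a i)%:MP : {mpoly D[N]})).

(* The permutation w acts on rational functions by x_i |-> x_(w i). *)
Definition factQ_frac : F :=
  ((N - size la)`!%:R)^-1 * \sum_(w : 'S_N)
    ((\prod_(i < N | (i < size la)%N) ffact (x (w i)) (nth 0%N la i)) *
     \prod_(i < N | (i < size la)%N) \prod_(j < N | (i < j)%N)
       ((x (w i) + x (w j)) / (x (w i) - x (w j)))).

(* factQ_frac is a polynomial in x_1, ..., x_N; factQ is that polynomial. *)
Definition factQ : {mpoly D[N]} :=
  if (size la <= N)%N then the 0 (fun p => FracField.tofrac p = factQ_frac) else 0.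
End FactorialQ.

Section DualFactorialP.
Variable K : numFieldType.
Local Notation A := (cpoly K).

(* P is the family of dual factorial P-functions, P la being relevant for strict
   la only.  The first condition says that the degree k part of P la is a
   C[a]-linear combination of Schur Q-functions (factQ at a = 0).  The second is
   the Cauchy identity, read in each degree k in y: there, only finitely many la
   contribute, and the identity of symmetric functions in x and y means equality
   for all finite sets x_1, ..., x_N and y_1, ..., y_M of variables. *)
Definition dual_factorial_P (P : seq nat -> hLambda A) : Prop :=
  (forall la k, strict_part la ->
     exists (s : seq (seq nat)) (c : seq nat -> A),
       all (fun mu => strict_part mu && (sumn mu == k)) s /\
       forall M, P la k M = \sum_(mu <- s) c mu *: factQ (fun=> 0) mu M) /\
  (forall k, exists s : seq (seq nat),
     [/\ uniq s, all strict_part s,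
         forall la M, strict_part la -> la \notin s -> P la k M = 0
       & forall N M, (\prod_(i < N) omega ('X_i : {mpoly A[N]})) k M =
           \sum_(la <- s) factQ (@avar K) la N *: map_mpoly (@mpolyC N A) (P la k M)]).
End DualFactorialP.

(* The periodic sequence a^(r), r = n.+1, of period (a_1, .., a_r, -a_r, .., -a_1). *)
Definition aper (K : numFieldType) n (i : nat) : {mpoly K[n.+1]} :=
  let r := (i %% n.+1.*2)%N in
  if (r < n.+1)%N then 'X_(inord r) else - 'X_(inord (n.+1.*2.-1 - r)).

(* Main.v *)
(* Interchanging a_j and a_(j+1), or replacing a_1 by -a_1 while adding a_1 to
   the variables x, changes Q_la(x|a) by an explicit multiple of one other
   Q_mu(x|a).  The Cauchy kernel is unchanged by the first operation and is
   multiplied by Omega(a_1|y) by the second.  As the Q_la are linearly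
   independent (evaluate at x = (a_(mu_1), a_(mu_2), ...)), comparing expansions
   shows that in infinite rank A_j adds a box to la in P_la, or kills P_la; in
   particular P_la only involves a_1, ..., a_(la_1).  After the specialization
   a^(n), s_i acts on the first 2n parameters by the two swaps (i, i+1) and
   (2n-i, 2n-i+1), and when |la| < 2n at most one of them moves P_la, so that
   A_i still adds a box.  In the group, when |la| < 2n, s_i w_la is w_mu for la
   with the same box added, or has length < |la|, or lies in w_la W.  Hence every
   reduced word of w builds up la_w one box at a time. *)
From HB Require Import structures.
Require Import Defs.
From mathcomp Require Import all_boot all_order all_algebra all_fingroup.
From mathcomp Require Import reals.
From mathcomp Require Import complex.
From mathcomp Require Import boolp finmap ring zify.
From mathcomp Require Import mpoly.
From mathcomp Require monalg.

Set Implicit Arguments.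
Unset Strict Implicit.
Unset Printing Implicit Defensive.

Import Order.TTheory GRing.Theory Num.Theory.
Local Open Scope ring_scope.

(** [factQ] is defined by a choice in a fraction field, so identities of Q-functions are proved for
    values at pairwise distinct points of a field, where the symmetrization becomes the recursive
    sum [qsum]. An evaluation need not extend to fractions; the passage from [factQ] to [qsum]
    therefore uses the numerator over the Vandermonde product.

    The Cauchy identity comes one degree in y at a time, each with its own finite support.
    Multiplication by Omega mixes degrees, hence supports common to all degrees up to k.

    The bound 2n has three uses. Before the last box is added every part is below 2n, so the entry
    -a_1 closing the period, which s_0 also negates, is not seen. The two swaps attached to s_i
    could both act only if parts q and 2n - q were both present. In the group, it keeps s_i within
    the range where it can slide through each rho_p.

    The partition built along a reduced word is identified with [lambda_of w] by injectivity of la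
    |-> w_la: la is read off the image of the origin under w_la. *)

Definition shifted_power (T : pzRingType) (v : nat -> T) (z : T) (k : nat) : T :=
  2 * z * \prod_(i < k.-1) (z - v i).

Lemma strict_part_uniq la : strict_part la -> uniq la.
Proof.
case/andP => st _; apply: sorted_uniq st => [|x]; last by rewrite /= ltnn.
exact: rev_trans ltn_trans.
Qed.

Definition flip0 (T : zmodType) (v : nat -> T) : nat -> T :=
  fun i => if i == 0%N then - v 0%N else v i.

(** * Evaluations of factorial Q-functions *)

Section PeeledSum.
Variable F : fieldType.
Implicit Types (v : nat -> F) (s : seq F) (la : seq nat) (x y t : F).

(* qsum v la s is the factorial Q-function Q_la(s|v) at pairwise distinct points
   s, expanded according to the point carrying the first part of la. *)
Definition cross x s : F := \prod_(y <- s | y != x) ((x + y) / (x - y)).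

Fixpoint qsum v la s : F :=
  if la is p :: la' then
    \sum_(x <- s) shifted_power v x p * cross x s * qsum v la' [seq y <- s | y != x]
  else 1.

Lemma cross_perm x s s' : perm_eq s s' -> cross x s = cross x s'.
Proof. exact: perm_big. Qed.

Lemma qsum_perm v la s s' : perm_eq s s' -> qsum v la s = qsum v la s'.
Proof.
elim: la s s' => //= p la IH s s' ss'; rewrite (perm_big _ ss').
apply: eq_bigr => x _; rewrite (cross_perm x ss'); congr (_ * _).
by apply: IH; rewrite perm_filter.
Qed.

Lemma filter_neq_notin x s : x \notin s -> [seq y <- s | y != x] = s.
Proof.
by move=> xs; apply/all_filterP/allP => y ys; apply: contraNneq xs => <-.
Qed.

Lemma cross_cons x y s : cross x (y :: s) =
  (if y != x then (x + y) / (x - y) else 1) * cross x s.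
Proof. by rewrite /cross big_cons; case: ifP; rewrite // mul1r. Qed.

(** As a function of t the product has value 1 at infinity and simple poles at the points x of s,
    with residue 2 x [cross x s]. *)
Lemma partial_fractions t s : uniq s -> t \notin s ->
  \prod_(x <- s) ((t + x) / (t - x)) =
  1 + \sum_(x <- s) 2 * x / (t - x) * cross x s.
Proof.
elim: s t => [|u s IH] t /=; first by rewrite !big_nil addr0.
rewrite inE negb_or => /andP[us Us] /andP[tu ts].
have cu : cross u (u :: s) = 1 + \sum_(x <- s) 2 * x / (u - x) * cross x s.
  rewrite -IH // cross_cons eqxx mul1r /cross big_seq_cond [RHS]big_seq_cond.
  apply: eq_bigl => x; case xs: (x \in s) => //=.
  by apply: contraNneq us => <-.
rewrite !big_cons cu IH //.
have tu0 : t - u != 0 by rewrite subr_eq0.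
have -> : \sum_(x <- s) 2 * x / (t - x) * cross x (u :: s) =
    (t + u) / (t - u) * \sum_(x <- s) 2 * x / (t - x) * cross x s
    - 2 * u / (t - u) * \sum_(x <- s) 2 * x / (u - x) * cross x s.
  rewrite !mulr_sumr -sumrB big_seq [RHS]big_seq; apply: eq_bigr => x xs.
  have ux : u != x by apply: contraNneq us => ->.
  have tx : t != x by apply: contraNneq ts => ->.
  rewrite cross_cons ux; field.
  by rewrite !subr_eq0 ux tx tu eq_sym ux.
by field.
Qed.

Lemma shifted_power1 v x : shifted_power v x 1 = 2 * x.
Proof. by rewrite /shifted_power big_ord0 mulr1. Qed.

(** Q_1 is twice the sum of the variables, whatever the parameters; partial fractions yield one
    increment of this sum. *)
Lemma qsum1_cons v u s : u \notin s -> uniq s ->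
  qsum v [:: 1] (u :: s) = qsum v [:: 1] s + 2 * u.
Proof.
move=> us Us; rewrite /= !(eq_bigr _ (fun x _ => mulr1 _)) big_cons.
rewrite shifted_power1 cross_cons eqxx mul1r.
have -> : cross u s = 1 + \sum_(x <- s) 2 * x / (u - x) * cross x s.
  rewrite -partial_fractions // /cross big_seq_cond [RHS]big_seq_cond.
  apply: eq_bigl => x; case xs: (x \in s) => //=.
  by apply: contraNneq us => <-.
rewrite mulrDr mulr1 [RHS]addrC -addrA; congr (_ + _).
rewrite mulr_sumr -big_split /= big_seq [RHS]big_seq; apply: eq_bigr => x xs.
have ux : u != x by apply: contraNneq us => ->.
rewrite cross_cons ux !shifted_power1; field.
by rewrite !subr_eq0 ux eq_sym ux.
Qed.

(** The factor x - v 0 of the shifted power cancels the pole of the crossing factor and leaves x + v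
    0. For k = 1 there is no such factor. *)
Lemma shifted_power_flip0 v x k : (1 < k)%N -> x != v 0%N ->
  shifted_power v x k * ((x + v 0%N) / (x - v 0%N)) = shifted_power (flip0 v) x k.
Proof.
case: k => [|[|k]] // _ xv; rewrite /shifted_power /= !big_ord_recl /= /flip0 /= opprK.
have -> : \prod_(i < k) (x - (if bump 0 i == 0%N then - v 0%N else v (bump 0 i))) =
  \prod_(i < k) (x - v (bump 0 i)) by [].
by field; rewrite subr_eq0.
Qed.

Lemma shifted_power_root v i k : (i.+1 < k)%N -> shifted_power v (v i) k = 0.
Proof.
case: k => // k lt; rewrite /shifted_power (bigD1 (Ordinal (lt : (i < k)%N))) //=.
by rewrite subrr mul0r mulr0.
Qed.

(** A part at least 2 cannot sit at the point v 0, a root of its shifted power. This point thus only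
    contributes crossing factors, which negate the first parameter. *)
Lemma qsum_flip0 v la s : uniq s -> v 0%N \notin s -> all (leq 2) la ->
  qsum v la (v 0%N :: s) = qsum (flip0 v) la s.
Proof.
elim: la s => //= p la IH s Us vs /andP[p2 la2].
rewrite big_cons shifted_power_root // !mul0r add0r big_seq [RHS]big_seq.
apply: eq_bigr => x xs; have xv : x != v 0%N by apply: contraNneq vs => <-.
rewrite cross_cons eq_sym xv mulrA shifted_power_flip0 //; congr (_ * _).
by rewrite IH ?filter_uniq // mem_filter negb_and vs orbT.
Qed.

(** The part 1 is the only one that the point v 0 can carry, its shifted power 2 x being free of
    parameters; this gives the extra term. *)
Lemma qsum_flip0_rcons v la s : uniq s -> v 0%N \notin s -> all (leq 2) la ->
  qsum v (rcons la 1) (v 0%N :: s) =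
  qsum (flip0 v) (rcons la 1) s + 2 * v 0%N * qsum (flip0 v) la s.
Proof.
elim: la s => [|p la IH] s Us vs.
  move=> _; rewrite [LHS]qsum1_cons // mulr1; congr (_ + _) => /=.
  by apply: eq_bigr => x _; rewrite !shifted_power1.
rewrite [all _ _]/= => /andP[p2 la2] /=.
rewrite big_cons shifted_power_root // !mul0r add0r mulr_sumr -big_split /=.
rewrite big_seq [RHS]big_seq.
apply: eq_bigr => x xs; have xv : x != v 0%N by apply: contraNneq vs => <-.
rewrite cross_cons eq_sym xv mulrA shifted_power_flip0 // IH ?filter_uniq //.
  ring.
by rewrite mem_filter negb_and vs orbT.
Qed.

Definition swapn (j i : nat) : nat :=
  if i == j then j.+1 else if i == j.+1 then j else i.

Lemma swapnK j : involutive (swapn j).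
Proof. rewrite /swapn => i; repeat case: eqP; lia. Qed.

Lemma swapnL j : swapn j j = j.+1.
Proof. by rewrite /swapn eqxx. Qed.

Lemma swapnR j : swapn j j.+1 = j.
Proof. by rewrite /swapn eqxx; case: eqP => // ?; lia. Qed.

Lemma swapn_id j i : i != j -> i != j.+1 -> swapn j i = i.
Proof. by rewrite /swapn => /negPf -> /negPf ->. Qed.

(** The factors with roots v j and v j.+1 are both present or both absent, unless the product stops
    exactly between them. *)
Lemma shifted_power_swap v x j k : k != j.+2 ->
  shifted_power (v \o swapn j) x k = shifted_power v x k.
Proof.
move=> kj; rewrite /shifted_power; congr (_ * _).
rewrite -!(big_mkord xpredT (fun i => x - _ i)).
have [le|gt] := leqP k.-1 j.
  by apply: eq_big_nat => i lt_i; rewrite /= /swapn; do 2?case: eqP => //; lia.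
have split0 (f : nat -> F) : \prod_(0 <= i < k.-1) f i = \prod_(0 <= i < j) f i *
    (f j * f j.+1 * \prod_(j.+2 <= i < k.-1) f i).
  rewrite (@big_cat_nat _ _ _ j) //; last exact: ltnW.
  have lt2 : (j.+1 < k.-1)%N by move/eqP: kj gt; case: (k) => [|[|i]] //=; lia.
  by rewrite (big_ltn gt) (big_ltn lt2) /= !mulrA.
rewrite (split0 (fun i => x - (v \o swapn j) i)) (split0 (fun i => x - v i)).
congr (_ * (_ * _)).
- by apply: eq_big_nat => i lt_i; rewrite /= /swapn; do 2?case: eqP => //; lia.
- by rewrite /= /swapn !eqxx gtn_eqF // mulrC.
- by apply: eq_big_nat => i lt_i; rewrite /= /swapn; do 2?case: eqP => //; lia.
Qed.

Lemma shifted_power_swap_eq v x j :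
  shifted_power (v \o swapn j) x j.+2 =
  shifted_power v x j.+2 + (v j - v j.+1) * shifted_power v x j.+1.
Proof.
rewrite /shifted_power /= !big_ord_recr /=.
have -> : swapn j j = j.+1 by rewrite /swapn eqxx.
rewrite (eq_bigr (fun i : 'I_j => x - v i)).
  by ring.
by move=> i _; rewrite /swapn (ltn_eqF (ltn_ord i)) (ltn_eqF (leqW (ltn_ord i))).
Qed.

Lemma eq_qsum v v' la s :
  (forall k x, k \in la -> shifted_power v' x k = shifted_power v x k) ->
  qsum v' la s = qsum v la s.
Proof.
elim: la s => //= p la IH s E; apply: eq_bigr => x _; rewrite E ?mem_head // IH //.
by move=> k y kla; apply: E; rewrite inE kla orbT.
Qed.

Lemma qsum_linear v v' (A B : seq nat) p p' (c : F) s :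
  (forall k x, k \in A ++ B -> shifted_power v' x k = shifted_power v x k) ->
  (forall x, shifted_power v' x p = shifted_power v x p + c * shifted_power v x p') ->
  qsum v' (A ++ p :: B) s = qsum v (A ++ p :: B) s + c * qsum v (A ++ p' :: B) s.
Proof.
elim: A s => [|q A IH] s E Ep /=; rewrite mulr_sumr -big_split; apply: eq_bigr => x _ /=.
  by rewrite Ep (eq_qsum _ E); ring.
rewrite E ?mem_head // IH //; first by ring.
by move=> k y kla; apply: E; rewrite inE kla orbT.
Qed.

Lemma sum_pairs_antisym s (f : F -> F -> F) : (2 : F) != 0 -> uniq s ->
  (forall x y, x \in s -> y \in s -> x != y -> f x y = - f y x) ->
  \sum_(x <- s) \sum_(y <- s | y != x) f x y = 0.
Proof.
move=> two Us fN; set S := (X in X = 0); suff: S = - S.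
  move/eqP; rewrite -subr_eq0 opprK => /eqP E.
  have : 2 * S == 0 by rewrite mulr_natl mulr2n E.
  by rewrite mulf_eq0 (negPf two) => /eqP.
  rewrite {1}/S (exchange_big_dep xpredT) //= -sumrN big_seq [RHS]big_seq.
  apply: eq_bigr => y ys; rewrite -sumrN big_seq_cond [RHS]big_seq_cond.
  apply: eq_big => [x|x]; first by rewrite eq_sym.
  by move=> /andP[xs]; rewrite eq_sym => xy; exact: fN.
Qed.

(** Exchanging the points x, y that carry the two equal parts only changes the sign of (x + y) / (x
    - y). *)
Lemma qsum_repeat v (A B : seq nat) p s : (2 : F) != 0 -> uniq s ->
  qsum v (A ++ p :: p :: B) s = 0.
Proof.
move=> two; elim: A s => [|q A IH] s Us; last first.
  by rewrite /= big1 // => x _; rewrite IH ?filter_uniq // mulr0.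
rewrite /=; under eq_bigr => x _ do rewrite big_filter mulr_sumr.
apply: sum_pairs_antisym => // x y xs ys xy.
have crossE u w : w \in s -> u != w -> cross u s =
    (u + w) / (u - w) * cross u [seq z <- s | z != w].
  move=> ws uw; rewrite /cross -big_filter (bigD1_seq w) ?filter_uniq //=; last first.
    by rewrite mem_filter eq_sym uw.
  by rewrite !big_filter_cond; congr (_ * _); apply: eq_bigl => z; rewrite andbC.
have -> : [seq z <- [seq z <- s | z != y] | z != x] =
    [seq z <- [seq z <- s | z != x] | z != y].
  by rewrite -!filter_predI; apply: eq_filter => z /=; rewrite andbC.
rewrite (crossE x y) // (crossE y x) 1?eq_sym //.
field; rewrite !subr_eq0 xy eq_sym xy //.
Qed.

(** Only the part j+2 sees the swap, and its shifted power changes by a multiple of the one for j+1.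
    If j+1 is also a part, it stands next to j+2, so the correction has a repeated part and
    vanishes. *)
Lemma qsum_swap v j la s : (2 : F) != 0 -> uniq s -> strict_part la ->
  qsum (v \o swapn j) la s = qsum v la s +
  (if (j.+2 \in la) && (j.+1 \notin la)
   then (v j - v j.+1) * qsum v (map (swapn j.+1) la) s else 0).
Proof.
move=> two Us /andP[st _]; case: (boolP (j.+2 \in la)) => [|nj] /=; last first.
  rewrite addr0; apply: eq_qsum => k x kla; rewrite shifted_power_swap //.
  by apply: contraNneq nj => <-.
move=> jla; move: st; case/splitPr: jla => A B st.
have gtA k : k \in A -> (j.+2 < k)%N.
  move=> kA; move: st; rewrite (sorted_pairwise (rev_trans ltn_trans)).
  rewrite pairwise_cat => /and3P[/allrelP H _ _].
  by apply: H => //; rewrite mem_head.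
have ltB k : k \in B -> (k < j.+2)%N.
  move=> kB; move: st; rewrite (sorted_pairwise (rev_trans ltn_trans)).
  rewrite pairwise_cat => /and3P[_ _ /andP[/allP H _]].
  exact: H.
rewrite (@qsum_linear v _ A B _ j.+1 (v j - v j.+1)); last 2 first.
- move=> k x; rewrite mem_cat => /orP[/gtA|/ltB] lt; apply: shifted_power_swap; lia.
- by move=> x; exact: shifted_power_swap_eq.
congr (_ + _); case: ifPn => [njla|].
  rewrite map_cat /= {2}/swapn eqxx ifF; last lia.
  have E (C : seq nat) : (forall k, k \in C -> k != j.+2 /\ k != j.+1) ->
      map (swapn j.+1) C = C.
    move=> CE; rewrite -[RHS]map_id; apply/eq_in_map => k /CE[k2 k1].
    by rewrite /swapn (negPf k1) (negPf k2).
  rewrite !E // => k kC; split.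
  - by have := ltB k kC; lia.
  - by apply: contraNneq njla => <-; rewrite mem_cat inE kC !orbT.
  - by have := gtA k kC; lia.
  - by have := gtA k kC; lia.
rewrite negbK mem_cat inE => /or3P[/gtA|/eqP|jB]; [lia|lia|].
have -> : B = j.+1 :: behead B.
  have : pairwise gtn B.
    move: st; rewrite (sorted_pairwise (rev_trans ltn_trans)) pairwise_cat.
    by move=> /and3P[_ _ /andP[]].
  case: B jB ltB {st} => //= b B; rewrite inE => /orP[/eqP <- //|jB] ltB.
  by move=> /andP[/allP/(_ _ jB) /=]; have := ltB b (mem_head _ _); lia.
by rewrite qsum_repeat // mulr0.
Qed.

Lemma sum_seq_neq0 (T : eqType) (r : seq T) (f : T -> F) :
  \sum_(i <- r) f i != 0 -> exists2 i, i \in r & f i != 0.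
Proof.
move=> nz; apply/hasP; apply: contraNT nz => /hasPn f0.
by rewrite big_seq big1 // => i /f0 /negPn/eqP.
Qed.

Section Interpolation.
Variable v : nat -> F.
Hypothesis v_inj : injective v.
Hypothesis v_add : forall i j, v i + v j != 0.
Let pts (mu : seq nat) := [seq v m.-1 | m <- mu].

Lemma pts_filter m mu : m != 0%N -> 0%N \notin mu ->
  [seq y <- pts mu | y != v m.-1] = pts [seq k <- mu | k != m].
Proof.
move=> m0 mu0; rewrite /pts filter_map; congr map; apply: eq_in_filter => k kmu /=.
rewrite (inj_eq v_inj); congr (~~ _); apply/eqP/eqP => [|-> //].
by case: k m kmu m0 => [|k] [|m] //= kmu; rewrite ?(negPf mu0) // in kmu; move=> _ ->.
Qed.

(** A part p can sit at v m.-1 only if p <= m, this point being a root otherwise. A nonzero term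
    thus matches the parts of la with distinct parts of mu that dominate them. *)
Lemma qsum_support la mu : uniq mu -> 0%N \notin mu -> qsum v la (pts mu) != 0 ->
  (sumn la <= sumn mu)%N /\ (sumn la = sumn mu -> perm_eq la mu).
Proof.
elim: la mu => [|p la IH] mu Umu mu0 /=.
  move=> _; split=> //; case: mu Umu mu0 => // m mu _; rewrite inE /=.
  by case: m.
move/sum_seq_neq0 => [_ /mapP[m mmu ->]].
have m0 : m != 0%N by apply: contraNneq mu0 => <-.
rewrite pts_filter // => nz; move: (nz); rewrite mulf_eq0 => /norP[nz1 nz2].
have [||le E] := IH _ _ _ nz2; rewrite ?filter_uniq ?mem_filter ?negb_and ?mu0 ?orbT //.
have pm : perm_eq mu (m :: [seq k <- mu | k != m]).
  by have := perm_to_rem mmu; rewrite rem_filter.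
have sm : sumn mu = (m + sumn [seq k <- mu | k != m])%N by rewrite (perm_sumn pm).
have pm' : (p <= m)%N.
  rewrite leqNgt; apply: contra_neqN nz1 => lt.
  by rewrite shifted_power_root ?mul0r // prednK // lt0n.
rewrite sm; split; first exact: leq_add.
move=> E'; have pE : p = m by lia.
rewrite (permPr pm) pE perm_cons; apply: E; lia.
Qed.

(** The points of the smaller parts are roots of the shifted power of the largest one, so
    recursively a single term survives. *)
Lemma qsum_diag la : strict_part la -> qsum v la (pts la) != 0.
Proof.
elim: la => [|p la IH]; first by rewrite oner_neq0.
rewrite /strict_part inE negb_or => /andP[/= st /andP[p0 la0]].
have lap : all (gtn p) la by exact: order_path_min (rev_trans ltn_trans) st.
have pla : p \notin la by apply/negP => /(allP lap) /=; rewrite ltnn.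
have vp : v p.-1 \notin pts la.
  apply/mapP => -[m mla /v_inj E]; have : p = m; last by move=> pm; rewrite pm mla in pla.
  by move: mla E p0; case: (m) (p) => [|k] [|q] //=; rewrite ?(negPf la0) // => _ ->.
rewrite big_cons big_seq big1 => [|x xs]; last first.
  have /mapP[m mla ->] := xs; have := allP lap _ mla => /= ltmp.
  by rewrite shifted_power_root ?mul0r // prednK // lt0n; apply: contraNneq la0 => <-.
rewrite addr0 /= eqxx /= filter_neq_notin // mulf_neq0 //; last by apply: IH; rewrite /strict_part (path_sorted st).
rewrite mulf_neq0 //.
- have /andP[t2 vp0] : ((2 : F) != 0) && (v p.-1 != 0).
    by rewrite -negb_or -mulf_eq0 mulr_natl mulr2n v_add.
  rewrite /shifted_power !mulf_neq0 //; apply/prodf_neq0 => i _; rewrite subr_eq0.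
  by rewrite (inj_eq v_inj) gtn_eqF.
- rewrite /cross prodf_seq_neq0; apply/allP => x; rewrite inE => /predU1P[->|].
    by rewrite eqxx.
  move=> /mapP[m mla ->]; apply/implyP => ne.
  by rewrite mulf_neq0 ?v_add // invr_neq0 // subr_eq0 eq_sym.
Qed.

(** The matrix of values is triangular for the size: at the points of la, every other partition of
    at least the same size vanishes, and the smaller ones are handled by induction. *)
Lemma qsum_indep (s : seq (seq nat)) (c : seq nat -> F) : uniq s -> all strict_part s ->
  (forall mu, strict_part mu -> \sum_(la <- s) c la * qsum v la (pts mu) = 0) ->
  forall la, la \in s -> c la = 0.
Proof.
move=> Us /allP strs E la; have [k] := ubnP (sumn la); elim: k la => // k IH la le las.
have gtn_tr : transitive gtn := rev_trans ltn_trans.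
have sla := strs _ las; have := E _ sla.
rewrite (bigD1_seq la) //= big_seq_cond big1 ?addr0 => [/eqP|nu /andP[nus ne]].
  by rewrite mulf_eq0 (negPf (qsum_diag sla)) orbF => /eqP.
have [-> | nz] := eqVneq (qsum v nu (pts la)) 0; first by rewrite mulr0.
have [||lenu P] := qsum_support _ _ nz; [exact: strict_part_uniq | by case/andP: sla |].
rewrite IH ?mul0r //; move: lenu; rewrite leq_eqVlt => /orP[/eqP /P pe|]; last lia.
case/eqP: ne; apply: (sorted_eq gtn_tr) pe; first by move=> x y /=; lia.
  by case/andP: (strs _ nus).
by case/andP: sla.
Qed.

(* The two sides of the hypothesis are expansions in the same family; D, dn
   and U, up describe the partial bijection dn and its inverse. *)
Lemma qsum_transfer (s : seq (seq nat)) (c c' : seq nat -> F) (b : F)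
    (D U : pred (seq nat)) (dn up : seq nat -> seq nat) :
  uniq s -> all strict_part s ->
  (forall la, strict_part la -> la \notin s -> c la = 0 /\ c' la = 0) ->
  (forall la, strict_part la -> D la ->
     [/\ strict_part (dn la), U (dn la) & up (dn la) = la]) ->
  (forall mu, strict_part mu -> U mu ->
     [/\ strict_part (up mu), D (up mu) & dn (up mu) = mu]) ->
  (forall mu, strict_part mu ->
     \sum_(la <- s) c' la * qsum v la (pts mu) =
     \sum_(la <- s) c la * (qsum v la (pts mu) +
        if D la then b * qsum v (dn la) (pts mu) else 0)) ->
  forall mu, strict_part mu -> c' mu = c mu + if U mu then b * c (up mu) else 0.
Proof.
move=> Us strs c0 dnP upP E.
pose e mu := c' mu - c mu - if U mu then b * c (up mu) else 0.
(* Moving the terms along [dn] may lead out of s, so coefficients are compared over s together with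
   its images. *)
pose t := undup (s ++ map dn (filter D s)).
have Ut : uniq t by exact: undup_uniq.
have strt : all strict_part t.
  apply/allP => la; rewrite mem_undup mem_cat => /orP[/(allP strs) //|/mapP[nu + ->]].
  by rewrite mem_filter => /andP[Dn /(allP strs) sn]; case: (dnP _ sn Dn).
have sub (f : seq nat -> F) : (forall la, la \in t -> la \notin s -> f la = 0) ->
    \sum_(la <- s) f la = \sum_(la <- t) f la.
  move=> f0; rewrite [RHS](bigID (mem s)) /= [X in _ + X]big_seq_cond [X in _ + X]big1 ?addr0.
    rewrite -[RHS]big_filter; apply: perm_big; apply: uniq_perm => //.
      by rewrite filter_uniq.
    by move=> la; rewrite mem_filter mem_undup mem_cat; case: (la \in s).
  by move=> la /andP[lat las]; apply: f0.
suff e0 mu : strict_part mu -> e mu = 0.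
  by move=> mu /e0/eqP; rewrite /e -addrA -opprD subr_eq0 => /eqP.
have [mut _|mut smu] := boolP (mu \in t); last first.
  have mus : mu \notin s by apply: contra mut; rewrite mem_undup mem_cat => ->.
  rewrite /e; have [-> ->] := c0 _ smu mus; rewrite subrr sub0r; case: ifP => Um; rewrite ?oppr0 //.
  have [su Du du] := upP _ smu Um.
  rewrite (c0 _ su _).1 ?mulr0 ?oppr0 //; apply: contra mut => us.
  by rewrite mem_undup mem_cat -du map_f ?orbT // mem_filter Du.
apply: (qsum_indep Ut strt) mut => nu snu.
under eq_bigr => la _ do rewrite /e !mulrBl.
rewrite !sumrB -(sub (fun la => c la * _)) -1?(sub (fun la => c' la * _)); last 2 first.
- by move=> la lat las; rewrite (c0 _ (allP strt _ lat) las).2 mul0r.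
- by move=> la lat las; rewrite (c0 _ (allP strt _ lat) las).1 mul0r.
rewrite E //; under eq_bigr => la _ do rewrite mulrDr.
rewrite big_split /= [X in X - _]addrAC subrr add0r.
apply/eqP; rewrite subr_eq0; apply/eqP.
(* [g] lives on the graph of [dn]: summing it by source or by image gives the two sides. *)
pose g la mu := if D la && (dn la == mu) then c la * (b * qsum v mu (pts nu)) else 0.
transitivity (\sum_(la <- s) \sum_(mu <- t) g la mu).
  rewrite big_seq [RHS]big_seq; apply: eq_bigr => la las; rewrite /g.
  case: ifP => Dl; last by rewrite mulr0 big1.
  have dt : dn la \in t by rewrite mem_undup mem_cat map_f ?orbT // mem_filter Dl.
  rewrite (bigD1_seq (dn la)) //= eqxx big1 ?addr0 // => m.
  by rewrite eq_sym => /negPf ->.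
rewrite exchange_big /= big_seq [RHS]big_seq; apply: eq_bigr => m mt.
have sm := allP strt _ mt; rewrite /g; case: ifP => Um; last first.
  rewrite mul0r big_seq big1 // => la las; case: ifP => // /andP[Dl /eqP dm].
  by have [_] := dnP _ (allP strs _ las) Dl; rewrite dm Um.
have [su Du du] := upP _ sm Um.
have [us|us] := boolP (up m \in s).
  rewrite (bigD1_seq (up m)) //= Du du eqxx big_seq_cond big1 ?addr0.
    by rewrite mulrCA mulrA.
  move=> la /andP[las ne]; case: ifP => // /andP[Dl /eqP dm].
  by have [_ _] := dnP _ (allP strs _ las) Dl; rewrite dm => E'; rewrite E' eqxx in ne.
rewrite (c0 _ su us).1 mulr0 mul0r big_seq big1 // => la las.
case: ifP => // /andP[Dl /eqP dm].
by have [_ _] := dnP _ (allP strs _ las) Dl; rewrite dm => E'; rewrite E' las in us.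
Qed.
End Interpolation.
End PeeledSum.

(** * Polynomiality of factQ and its evaluation at distinct points *)

Lemma sum_lift_perm (V : nmodType) n (f : 'S_n.+1 -> V) :
  \sum_w f w = \sum_m \sum_(w : 'S_n) f (lift_perm ord0 m w).
Proof.
rewrite pair_big /= (reindex (fun p : 'I_n.+1 * 'S_n => lift_perm ord0 p.1 p.2)) //=.
apply: onW_bij; apply: inj_card_bij => [[m w] [m' w'] /= E|].
  have mm : m = m' by rewrite -(lift_perm_id ord0 m w) E lift_perm_id.
  congr (_, _) => //; apply/permP => k; apply: (@lift_inj _ m).
  by rewrite -(lift_perm_lift ord0) E mm lift_perm_lift.
by rewrite card_prod !card_Sn card_ord factS.
Qed.

Lemma prod_ord_lt_recl (R : pzSemiRingType) n l (f : 'I_n.+1 -> R) :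
  \prod_(i < n.+1 | (i < l.+1)%N) f i =
  f ord0 * \prod_(i < n | (i < l)%N) f (lift ord0 i).
Proof. by rewrite big_mkcond big_ord_recl [in RHS]big_mkcond. Qed.

Lemma prod_ord_gt0_recl (R : pzSemiRingType) n (f : 'I_n.+1 -> R) :
  \prod_(i < n.+1 | (0 < i)%N) f i = \prod_(i < n) f (lift ord0 i).
Proof. by rewrite big_mkcond big_ord_recl /= mul1r [in RHS]big_mkcond. Qed.

Lemma prod_ord_gt_recl (R : pzSemiRingType) n m (f : 'I_n.+1 -> R) :
  \prod_(i < n.+1 | (m.+1 < i)%N) f i = \prod_(i < n | (m < i)%N) f (lift ord0 i).
Proof. by rewrite big_mkcond big_ord_recl /= mul1r [in RHS]big_mkcond. Qed.

Section PermutationSum.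
Variables (F : fieldType) (a : nat -> F).

Lemma qsum_oversize (la : seq nat) (s : seq F) :
  (size s < size la)%N -> qsum a la s = 0.
Proof.
elim: la s => //= p la IH s lt; rewrite big_seq big1 // => x xs.
rewrite IH ?mulr0 //; have pos : (0 < count_mem x s)%N by rewrite -has_count has_pred1.
rewrite -ltnS; apply: leq_trans lt; rewrite size_filter -(count_predC (pred1 x) s).
by rewrite ltnS -add1n leq_add2r.
Qed.

Lemma filter_map_lift N (x : 'I_N.+1 -> F) m : injective x ->
  perm_eq [seq y <- map x (enum 'I_N.+1) | y != x m] (map (x \o lift m) (enum 'I_N)).
Proof.
move=> x_inj; apply: uniq_perm => [||y].
- by rewrite filter_uniq // map_inj_uniq ?enum_uniq.
- by rewrite map_inj_uniq ?enum_uniq // => i j /x_inj /lift_inj.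
rewrite mem_filter; apply/andP/mapP => [[ne /mapP[k _ E]]|[k _ ->]].
  case: (unliftP m k) E => [j|] -> E; last by rewrite E eqxx in ne.
  by exists j; rewrite ?mem_enum.
by rewrite /= map_f ?mem_enum // (inj_eq x_inj) eq_sym neq_lift.
Qed.

(** Grouping the permutations by the index w 0 that receives the first part is the recursion of
    [qsum]; once no part is left, the (N - l)! orders of the remaining points contribute 1 each. *)
Lemma perm_sum_qsum N (la : seq nat) (x : 'I_N -> F) : injective x -> (size la <= N)%N ->
  \sum_(w : 'S_N)
    ((\prod_(i < N | (i < size la)%N) shifted_power a (x (w i)) (nth 0%N la i)) *
     \prod_(i < N | (i < size la)%N) \prod_(j < N | (i < j)%N)
       ((x (w i) + x (w j)) / (x (w i) - x (w j)))) =
  (N - size la)`!%:R * qsum a la (map x (enum 'I_N)).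
Proof.
elim: la N x => [|p la IH] N x x_inj /=.
  move=> _; rewrite subn0 mulr1 (eq_bigr (fun=> 1)) => [|w _].
    by rewrite sumr_const card_Sn.
  by rewrite !big_pred0 ?mulr1.
case: N x x_inj => // N x x_inj le; rewrite sum_lift_perm subSS big_map mulr_sumr.
rewrite big_enum; apply: eq_bigr => m _.
rewrite [in RHS](qsum_perm a la (filter_map_lift m x_inj)).
rewrite mulrCA -IH //; last by move=> i j /x_inj /lift_inj.
have -> : cross (x m) (map x (enum 'I_N.+1)) =
    \prod_(k < N) ((x m + x (lift m k)) / (x m - x (lift m k))).
  by rewrite /cross -big_filter (perm_big _ (filter_map_lift m x_inj)) big_map big_enum.
rewrite mulr_sumr; apply: eq_bigr => w _.
rewrite !prod_ord_lt_recl prod_ord_gt0_recl lift_perm_id /=.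
rewrite (eq_bigr (fun i : 'I_N => shifted_power a (x (lift m (w i))) (nth 0%N la i))); last first.
  by move=> i _; rewrite lift_perm_lift.
rewrite [X in _ * (X * _)](_ : _ =
    \prod_(k < N) ((x m + x (lift m k)) / (x m - x (lift m k)))); last first.
  rewrite [RHS](reindex_inj (@perm_inj _ w)); apply: eq_bigr => i _.
  by rewrite lift_perm_lift.
rewrite mulrACA; congr (_ * (_ * _)); apply: eq_bigr => i _.
rewrite /bump leq0n add1n prod_ord_gt_recl; apply: eq_bigr => j _.
by rewrite !lift_perm_lift.
Qed.
End PermutationSum.

Section Numerator.

Definition vdm (T : comPzRingType) N (x : 'I_N -> T) : T :=
  \prod_(i < N) \prod_(j < N | (i < j)%N) (x i - x j).

(* The alternating polynomial (N - l)! * vdm x * Q_la(x|a), l = size la. *)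
Definition numer (T : comPzRingType) (a : nat -> T) (la : seq nat) N (x : 'I_N -> T) : T :=
  \sum_(w : 'S_N) (-1) ^+ w *
    ((\prod_(i < N | (i < size la)%N) shifted_power a (x (w i)) (nth 0%N la i)) *
     (\prod_(i < N | (i < size la)%N) \prod_(j < N | (i < j)%N) (x (w i) + x (w j))) *
     (\prod_(i < N | ~~ (i < size la)%N) \prod_(j < N | (i < j)%N) (x (w i) - x (w j)))).

Lemma rmorph_shifted_power (T T' : comPzRingType) (f : {rmorphism T -> T'}) a x k :
  f (shifted_power a x k) = shifted_power (f \o a) (f x) k.
Proof.
rewrite /shifted_power !rmorphM rmorph_nat rmorph_prod; congr (_ * _).
by apply: eq_bigr => i _; rewrite rmorphB.
Qed.

Lemma rmorph_vdm (T T' : comPzRingType) (f : {rmorphism T -> T'}) N (x : 'I_N -> T) :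
  f (vdm x) = vdm (f \o x).
Proof.
rewrite rmorph_prod; apply: eq_bigr => i _; rewrite rmorph_prod.
by apply: eq_bigr => j _; rewrite rmorphB.
Qed.

Lemma rmorph_numer (T T' : comPzRingType) (f : {rmorphism T -> T'}) a la N (x : 'I_N -> T) :
  f (numer a la x) = numer (f \o a) la (f \o x).
Proof.
rewrite rmorph_sum; apply: eq_bigr => w _; rewrite !rmorphM rmorph_sign.
congr (_ * (_ * _ * _)); rewrite rmorph_prod; apply: eq_bigr => i _.
- exact: rmorph_shifted_power.
- by rewrite rmorph_prod; apply: eq_bigr => j _; rewrite rmorphD.
- by rewrite rmorph_prod; apply: eq_bigr => j _; rewrite rmorphB.
Qed.

Lemma vdm_perm (T : comPzRingType) N (x : 'I_N -> T) (w : 'S_N) :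
  vdm (x \o w) = (-1) ^+ w * vdm x.
Proof.
have E (y : 'I_N -> T) : vdm y = \det (Vandermonde N (\row_j - y j)).
  rewrite det_Vandermonde; apply: eq_bigr => i _; apply: eq_bigr => j _.
  by rewrite !mxE opprK addrC.
rewrite !E mulrC -odd_permV -det_perm -det_mulmx -col_permE; congr (\det _).
by apply/matrixP => i j; rewrite !mxE.
Qed.

Lemma vdm_neq0 (T : idomainType) N (x : 'I_N -> T) : injective x -> vdm x != 0.
Proof.
move=> x_inj; apply/prodf_neq0 => i _; apply/prodf_neq0 => j lt.
by rewrite subr_eq0 (inj_eq x_inj); apply/eqP => ij; rewrite ij ltnn in lt.
Qed.

(** The Vandermonde product taken in the order w cancels the denominators of the first l rows and
    leaves the differences of the other rows; restoring its order costs the sign of w. *)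
Lemma numer_frac (F : fieldType) (a : nat -> F) la N (x : 'I_N -> F) : injective x ->
  numer a la x = vdm x * \sum_(w : 'S_N)
    ((\prod_(i < N | (i < size la)%N) shifted_power a (x (w i)) (nth 0%N la i)) *
     \prod_(i < N | (i < size la)%N) \prod_(j < N | (i < j)%N)
       ((x (w i) + x (w j)) / (x (w i) - x (w j)))).
Proof.
move=> x_inj; rewrite mulr_sumr; apply: eq_bigr => w _.
have -> : vdm x = (-1) ^+ w * vdm (x \o w) by rewrite vdm_perm mulrA -expr2 sqrr_sign mul1r.
rewrite -[RHS]mulrA; congr (_ * _); rewrite -mulrA [RHS]mulrCA; congr (_ * _).
rewrite [vdm _](bigID (fun i : 'I_N => (i < size la)%N)) /= mulrAC; congr (_ * _).
rewrite -big_split; apply: eq_bigr => i _ /=; rewrite -big_split; apply: eq_bigr => j lt /=.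
rewrite mulrCA divff ?mulr1 // subr_eq0 (inj_eq x_inj) (inj_eq perm_inj).
by apply/eqP => ij; rewrite ij ltnn in lt.
Qed.

(** Composing w with the transposition of i and j keeps all values and flips the sign, so the sum
    equals its opposite. *)
Lemma numer_eq0 (T : idomainType) a la N (x : 'I_N -> T) i j : (2 : T) != 0 ->
  i != j -> x i = x j -> numer a la x = 0.
Proof.
move=> two ij xij; set S := numer _ _ _; suff E : S = - S.
  have : 2 * S == 0 by rewrite mulr_natl mulr2n {1}E addNr.
  by rewrite mulf_eq0 (negPf two) => /eqP.
rewrite {1}/S /numer (reindex_inj (@mulIg _ (tperm i j))) /= -sumrN.
apply: eq_bigr => w _; rewrite odd_permM odd_tperm ij addbT signrN mulNr.
congr (- (_ * _)).
have xw k : x ((w * tperm i j)%g k) = x (w k) by rewrite permM; case: tpermP => [->|->|].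
congr (_ * _ * _); apply: eq_bigr => k _; rewrite ?xw //;
  by apply: eq_bigr => l _; rewrite !xw.
Qed.
End Numerator.

Lemma mpolyX_inj (R : nzRingType) N : injective (fun i : 'I_N => 'X_i : {mpoly R[N]}).
Proof.
move=> i j /mpolyP /(_ U_(i)%MM); rewrite !mcoeffX eqxx; case: eqP => [E|_].
  by move: (congr1 (fun m : 'X_{1..N} => m i) E); rewrite !mnmE eqxx; case: eqP.
by move/eqP; rewrite oner_eq0.
Qed.

Section Polynomiality.
Variables (D : idomainType) (N : nat).
Local Notation P := {mpoly D[N]}.
Let X (i : 'I_N) : P := 'X_i.

(** The substitution X_i := X_j, that is, reduction modulo X_i - X_j. *)
Let merge (i j : 'I_N) : P -> P := comp_mpoly [tuple X (if k == i then j else k) | k < N].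

Let mergeX i j k : merge i j (X k) = X (if k == i then j else k).
Proof. by rewrite /merge /X comp_mpolyXU -tnth_nth tnth_mktuple. Qed.

Let merge_dvd i j p : exists q, p - merge i j p = (X i - X j) * q.
Proof.
have M u v : (exists q, u - merge i j u = (X i - X j) * q) ->
    (exists q, v - merge i j v = (X i - X j) * q) ->
    exists q, u * v - merge i j (u * v) = (X i - X j) * q.
  move=> [q eq] [q' eq']; exists (q * v + merge i j u * q').
  rewrite mulrDr mulrA -eq mulrCA -eq' /merge rmorphM /= -/(merge i j u) -/(merge i j v).
  by rewrite mulrBl mulrBr addrA subrK.
have one : exists q, 1 - merge i j 1 = (X i - X j) * q.
  by exists 0; rewrite /merge rmorph1 subrr mulr0.
elim/mpolyind: p => [|c m p _ _ [q' IH]].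
  by exists 0; rewrite /merge rmorph0 subrr mulr0.
have [q eq] : exists q, 'X_[m] - merge i j 'X_[m] = (X i - X j) * q.
  rewrite mpolyXE_id; elim/big_ind: _ => [|u v|k _]; [exact: one | exact: M |].
  elim: (m k) => [|l IHl]; first by rewrite expr0; exact: one.
  rewrite exprS; apply: (M (X k) _ _ IHl).
  rewrite mergeX; case: eqVneq => [->|_]; first by exists 1; rewrite mulr1.
  by exists 0; rewrite subrr mulr0.
exists (c *: q + q'); rewrite /merge rmorphD /= comp_mpolyZ -/(merge i j _) -/(merge i j p).
by rewrite opprD addrACA IH -scalerBr eq mulrDr -scalerAr.
Qed.

(** The factors are divided out one by one: merging i and j does not kill X_k - X_l for another pair
    k < l, hence it kills the quotient found so far. *)
Lemma dvd_prod_diff (s : seq ('I_N * 'I_N)) (p : P) : uniq s ->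
  {in s, forall ij : 'I_N * 'I_N, (ij.1 < ij.2)%N} ->
  {in s, forall ij : 'I_N * 'I_N, merge ij.1 ij.2 p = 0} ->
  exists q, p = \prod_(ij <- s) (X ij.1 - X ij.2) * q.
Proof.
elim: s => [|[i j] s IH] /=; first by exists p; rewrite big_nil mul1r.
move=> /andP[ijs Us] lt p0; have lt_ij := lt _ (mem_head _ _).
have [||q E] := IH Us; first by move=> kl kls; apply: lt; rewrite inE kls orbT.
  by move=> kl kls; apply: p0; rewrite inE kls orbT.
suff q0 : merge i j q = 0.
  have [q' E'] := merge_dvd i j q; exists q'; rewrite q0 subr0 in E'.
  by rewrite E big_cons E' [RHS]mulrAC mulrC.
have := p0 _ (mem_head _ _); rewrite E /merge /= rmorphM /= => /eqP.
rewrite mulf_eq0 => /orP[|/eqP //]; rewrite rmorph_prod prodf_seq_eq0 => /hasP[[k l] kls /=].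
rewrite rmorphB /= -/(merge i j (X k)) -/(merge i j (X l)) -/(merge i j q) !mergeX subr_eq0 (inj_eq (@mpolyX_inj _ _)).
have lt_kl := lt (k, l); rewrite inE kls orbT in lt_kl; have {}lt_kl := lt_kl isT.
case: (eqVneq k i) (eqVneq l i) => [ki|ki] [li|li] /eqP E1; move: lt_ij lt_kl => /=.
- by rewrite ki li ltnn.
- by move=> _ _; case/negP: ijs; rewrite -ki E1.
- by rewrite E1 li => lt1 /(ltn_trans lt1); rewrite ltnn.
- by rewrite E1 ltnn.
Qed.

Lemma numer_dvd (a : nat -> P) la : (2 : P) != 0 ->
  (forall i j k, merge i j (a k) = a k) ->
  exists p, numer a la X = vdm X * p.
Proof.
move=> two aE; pose s := [seq ij : 'I_N * 'I_N <- enum {: 'I_N * 'I_N} | (ij.1 < ij.2)%N].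
have [|||q ->] := @dvd_prod_diff s (numer a la X).
- by rewrite filter_uniq ?enum_uniq.
- by move=> ij; rewrite mem_filter => /andP[].
- move=> [i j]; rewrite mem_filter /merge => /andP[/= lt _]; rewrite rmorph_numer.
  apply: (@numer_eq0 _ _ _ _ _ i j) => //=; first by apply: contraTneq lt => ->; rewrite ltnn.
  by rewrite -!/(merge i j _) !mergeX eqxx if_same.
exists q; congr (_ * q); rewrite /s big_filter big_enum_cond /=.
by rewrite /vdm pair_big_dep.
Qed.
End Polynomiality.

Section FactorialQEval.
Variable D : idomainType.
Hypothesis D_nat : forall k, exists u : D, u * k.+1%:R = 1.

Let natr_unit k : exists u : D, u * (k`!)%:R = 1.
Proof. by have [u uE] := D_nat (k`!).-1; exists u; rewrite prednK ?fact_gt0 in uE. Qed.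

(** Describes [factQ] without fractions. The chosen polynomial exists because the Vandermonde
    product divides [numer] and (N - l)! is invertible. *)
Lemma factQP (a : nat -> D) la N : (size la <= N)%N ->
  (N - size la)`!%:R * vdm (fun i : 'I_N => 'X_i) * factQ a la N =
  numer (@mpolyC N D \o a) la (fun i => 'X_i).
Proof.
move=> le; set X := (fun i : 'I_N => ('X_i : {mpoly D[N]})).
pose tf : {rmorphism {mpoly D[N]} -> {fraction {mpoly D[N]}}} := @FracField.tofrac _.
have two : (2 : {mpoly D[N]}) != 0.
  have [u uE] := D_nat 1; apply/eqP => two0.
  have /eqP : u%:MP_[N] * 2 = 1 by rewrite -[2](rmorph_nat (@mpolyC N D)) -rmorphM uE rmorph1.
  by rewrite two0 mulr0 eq_sym oner_eq0.
have X_inj : injective X by exact: mpolyX_inj.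
have tX_inj : injective (tf \o X).
  by move=> i j /eqP; rewrite /= tofrac_eq => /eqP /X_inj.
have [|p pE] := @numer_dvd D N (@mpolyC N D \o a) la two.
  by move=> i j k; exact: comp_mpolyC.
have [u uE] := natr_unit (N - size la).
have fE : tf (u%:MP_[N]) * ((N - size la)`!)%:R = 1.
  by rewrite -(rmorph_nat tf) -(rmorph_nat (@mpolyC N D)) -!rmorphM uE !rmorph1.
have fnz : ((N - size la)`!)%:R != 0 :> {fraction {mpoly D[N]}}.
  by apply/eqP => f0; move/eqP: fE; rewrite f0 mulr0 eq_sym oner_eq0.
have vnz : tf (vdm X) != 0 by rewrite tofrac_eq0 vdm_neq0.
have sumE := numer_frac (tf \o (@mpolyC N D \o a)) la tX_inj.
rewrite -rmorph_numer -rmorph_vdm in sumE.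
set sigma := (X in _ * X) in sumE.
have fracE : factQ_frac a la N = ((N - size la)`!%:R)^-1 * sigma by [].
have QE : tf (factQ a la N) = factQ_frac a la N.
  rewrite /factQ le; apply: (@theP _ 0 (fun p => FracField.tofrac p = factQ_frac a la N)).
  exists (u%:MP_[N] * p); rewrite rmorphM /=; apply: (mulfI fnz).
  rewrite fracE !mulrA [X in X * _]mulrC fE (divff fnz) !mul1r; apply: (mulfI vnz).
  by rewrite -rmorphM -pE.
apply/eqP; rewrite -tofrac_eq -/(tf _) rmorphM /= QE sumE !rmorphM /= rmorph_nat.
by rewrite fracE mulrA [X in X * _]mulrAC (divff fnz) mul1r.
Qed.

(** The fraction-free identity is mapped by g and then divided by the Vandermonde product, nonzero
    since the values are distinct. *)
Lemma eval_factQ (F : fieldType) (a : nat -> D) la N (g : {rmorphism {mpoly D[N]} -> F}) :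
  injective (fun i => g 'X_i) ->
  g (factQ a la N) =
  qsum (g \o @mpolyC N D \o a) la [seq g 'X_i | i <- enum 'I_N].
Proof.
move=> g_inj; have [le|gt] := leqP (size la) N; last first.
  rewrite [RHS]qsum_oversize; last by rewrite size_map size_enum_ord.
  by rewrite /factQ ifF ?rmorph0 //; apply/negbTE; rewrite -ltnNge.
have := congr1 g (factQP a le); rewrite rmorph_numer !rmorphM rmorph_vdm rmorph_nat /=.
rewrite (numer_frac _ _ g_inj) (perm_sum_qsum _ g_inj le) => E.
have [u uE] := natr_unit (N - size la).
have fE : g (u%:MP_[N]) * ((N - size la)`!)%:R = 1.
  by rewrite -(rmorph_nat g) -(rmorph_nat (@mpolyC N D)) -!rmorphM uE !rmorph1.
have fnz : ((N - size la)`!)%:R != 0 :> F.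
  by apply/eqP => f0; move/eqP: fE; rewrite f0 mulr0 eq_sym oner_eq0.
have vnz : vdm (fun i : 'I_N => g 'X_i) != 0 by exact: vdm_neq0.
apply: (mulfI (mulf_neq0 vnz fnz)); rewrite -[RHS]mulrA -E; congr (_ * _); exact: mulrC.
Qed.
End FactorialQEval.

(** * Substitutions in polynomials and in formal sums of symmetric functions *)

Section CPoly.
Import monalg.
Variable K : comNzRingType.
Local Notation A := (cpoly K).

Lemma cpoly_ind (Q : A -> Prop) :
  (forall c, Q c%:A) -> (forall p q, Q p -> Q q -> Q (p + q)) ->
  (forall i p, Q p -> Q (@avar K i * p)) -> forall p, Q p.
Proof.
move=> Qc QD QX p; rewrite (monalg.monalgE p); elim/big_ind: _ => //.
  by have := Qc 0; rewrite scale0r.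
move=> m _; move: (monalg.mcoeff m p) => c {p}.
have [k] := ubnP (monalg.mdeg m); elim: k m => // k IH m le_m.
have [m1|m1] := eqVneq m (monalg.one : monalg.cmonom nat).
  by rewrite m1 -[monalg.mkmalgU _ _]mulr1 monalg.mul_malgC; exact: Qc.
have /fset0Pn [i im] : finsupp m != fset0.
  apply: contraNneq m1 => m0; rewrite -monalg.mdeg_eq0 monalg.mdegE m0.
  by rewrite big_seq_fset0.
pose m' := monalg.divcm m (monalg.ucm i).
have mE : m = monalg.mul (monalg.ucm i) m'.
  apply/eqP/monalg.cmP => j; rewrite monalg.cmM monalg.divcmE monalg.cmU.
  case: eqP => [<-|_]; last by rewrite subn0.
  by rewrite addnC subnK // lt0n monalg.cmE_neq0.
have -> : monalg.mkmalgU m c = avar K i * monalg.mkmalgU m' c.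
  by rewrite /avar monalg.malgM_def monalg.fgmulUU mul1r -mE.
by apply/QX/IH; move: le_m; rewrite {1}mE monalg.mdegM monalg.mdegU add1n.
Qed.

Lemma asubst_const (S : comNzRingType) (f : {rmorphism K -> S}) v c :
  asubst f v c%:A = f c.
Proof. by rewrite /asubst monalg.mmapZ monalg.mmap1 mulr1. Qed.

Lemma rmorph_cpoly_eq (S : comNzRingType) (g h : {rmorphism A -> S}) :
  (forall c, g c%:A = h c%:A) -> (forall i, g (avar K i) = h (avar K i)) -> g =1 h.
Proof.
move=> gc gX; elim/cpoly_ind => [c|p q IHp IHq|i p IH]; first exact: gc.
  by rewrite !rmorphD IHp IHq.
by rewrite !rmorphM IH gX.
Qed.

Lemma asubst_comp (S : comNzRingType) (f : {rmorphism K -> S}) v u p :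
  asubst f v (asubst (in_alg A) u p) = asubst f (fun i => asubst f v (u i)) p.
Proof.
pose g : {rmorphism A -> S} := asubst f v \o asubst (in_alg A) u.
apply: (@rmorph_cpoly_eq _ g) => [c|i] /=; first by rewrite !asubst_const.
by rewrite !asubst_avar.
Qed.

Lemma eq_asubst (S : comNzRingType) (f : {rmorphism K -> S}) v v' :
  v =1 v' -> asubst f v =1 asubst f v'.
Proof.
move=> vv; apply: rmorph_cpoly_eq => [c|i] /=; first by rewrite !asubst_const.
by rewrite !asubst_avar.
Qed.

Lemma rmorph_asubst (S S' : comNzRingType) (f : {rmorphism K -> S})
    (g : {rmorphism S -> S'}) (h : {rmorphism K -> S'}) v p :
  (forall c, g (f c) = h c) -> g (asubst f v p) = asubst h (g \o v) p.
Proof.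
move=> gf; apply: (@rmorph_cpoly_eq _ (g \o asubst f v)) => [c|i] /=.
  by rewrite !asubst_const.
by rewrite !asubst_avar.
Qed.

Definition aswap (j : nat) : A -> A := asubst (in_alg A) (avar K \o swapn j).
HB.instance Definition _ j := GRing.RMorphism.on (aswap j).

Lemma asubst_aswap (S : comNzRingType) (f : {rmorphism K -> S}) v j p :
  asubst f v (aswap j p) = asubst f (v \o swapn j) p.
Proof. by rewrite asubst_comp; apply: eq_asubst => i; rewrite asubst_avar. Qed.

Lemma asubst_bounded (S : comNzRingType) (f : {rmorphism K -> S}) p :
  exists L, forall v v', (forall i, (i < L)%N -> v i = v' i) ->
    asubst f v p = asubst f v' p.
Proof.
elim/cpoly_ind: p => [c|p q [L IHp] [M IHq]|i p [L IH]].
- by exists 0%N => v v' _; rewrite !asubst_const.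
- exists (maxn L M) => v v' vv; rewrite !rmorphD /= (IHp v v') ?(IHq v v') // => i lt;
    by apply: vv; rewrite leq_max lt ?orbT.
- exists (maxn L i.+1) => v v' vv; rewrite !rmorphM /= !asubst_avar (IH v v') ?vv //.
    by rewrite leq_max leqnn orbT.
  by move=> k lt; apply: vv; rewrite leq_max lt.
Qed.

(* A polynomial symmetric in a_(m+1), a_(m+2), ... does not involve them: the
   last one that occurs could be swapped with its successor. *)
Lemma asubst_swap_inv (S : comNzRingType) (f : {rmorphism K -> S}) p m v v' :
  (forall j, (m <= j)%N -> aswap j p = p) ->
  (forall i, (i < m)%N -> v i = v' i) ->
  asubst f v p = asubst f v' p.
Proof.
move=> inv; have [L] := asubst_bounded f p; elim: L v v' => [|L IH] v v' bd vv.
  exact: bd.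
have [le|lt] := leqP L.+1 m; first by apply: bd => i li; apply/vv/(leq_trans li).
apply: (IH) vv => {v v'} v v' vv.
(* The value at L+1 does not affect p, so it may be set to v' L; swapping L and L+1 then replaces v
   L by v' L. *)
pose v1 i := if i == L.+1 then v' L else v i.
rewrite (bd v v1) => [|i li]; last by rewrite /v1 ltn_eqF.
rewrite -{1}(inv L) // asubst_aswap; apply: bd => i li; rewrite /v1 /= /swapn.
have [->|ne] := eqVneq i L; first by rewrite eqxx.
have li' : (i < L)%N by rewrite ltn_neqAle ne -ltnS.
by rewrite (ltn_eqF li) (ltn_eqF li) vv.
Qed.
End CPoly.

Section HMap.
Variables (R R' : comNzRingType) (phi : {rmorphism R -> R'}).
Implicit Types f g : hLambda R.

Fact hmap_zmod : zmod_morphism (hmap phi).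
Proof. by move=> f g; apply: hLambdaP => k N /=; rewrite rmorphB. Qed.
Fact hmap_monoid : monoid_morphism (hmap phi).
Proof.
split=> [|f g]; apply: hLambdaP => k N /=; first by rewrite rmorph_nat.
by rewrite rmorph_sum; apply: eq_bigr => i _; rewrite rmorphM.
Qed.
HB.instance Definition _ := GRing.isZmodMorphism.Build _ _ (hmap phi) hmap_zmod.
HB.instance Definition _ := GRing.isMonoidMorphism.Build _ _ (hmap phi) hmap_monoid.

Lemma map_mpolyZ_rmorph N c (p : {mpoly R[N]}) :
  map_mpoly phi (c *: p) = phi c *: map_mpoly phi p.
Proof.
by apply/mpolyP => m; rewrite mcoeffZ !mcoeff_map_mpoly mcoeffZ /= rmorphM.
Qed.

Lemma hmapZ c f : hmap phi (c *: f) = phi c *: hmap phi f.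
Proof. by apply: hLambdaP => k N /=; rewrite map_mpolyZ_rmorph. Qed.

Lemma hmap_omega u : hmap phi (omega u) = omega (phi u).
Proof.
apply: hLambdaP => k N /=; apply/mpolyP => m.
rewrite mcoeff_map_mpoly !mcoeff_pihomog; case: ifP => _; last exact: rmorph0.
rewrite -mcoeff_map_mpoly; congr (_@_m); rewrite /omega_trunc rmorph_prod.
apply: eq_bigr => j _; rewrite rmorphM rmorphD rmorph1 rmorph_sum /=.
have E : map_mpoly phi (u *: 'X_j) = phi u *: 'X_j by rewrite map_mpolyZ_rmorph map_mpolyX.
by rewrite E; congr (_ * _); apply: eq_bigr => r _; rewrite rmorphXn /= E.
Qed.
End HMap.

Lemma mcoeff_hmap (R R' : comNzRingType) (phi : {rmorphism R -> R'}) f k N m :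
  (hmap phi f k N)@_m = phi ((f k N)@_m).
Proof. exact: mcoeff_map_mpoly. Qed.

Lemma hmap_comp (R R' R'' : comNzRingType) (phi : {rmorphism R -> R'})
    (psi : {rmorphism R' -> R''}) (chi : {rmorphism R -> R''}) f :
  (forall x, psi (phi x) = chi x) -> hmap psi (hmap phi f) = hmap chi f.
Proof.
move=> E; apply: hLambdaP => k N; apply/mpolyP => m /=.
by rewrite !mcoeff_map_mpoly; exact: E.
Qed.

Lemma hscaleI (D : idomainType) (c : D) (f g : hLambda D) :
  c != 0 -> c *: f = c *: g -> f = g.
Proof.
move=> c0 E; apply: hLambdaP => k N; apply/mpolyP => m; apply: (mulfI c0).
by have := congr1 (fun h : hLambda D => (h k N)@_m) E; rewrite /= !mcoeffZ.
Qed.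

Lemma divdiffE (K : numFieldType) n i (f g : hLambda {mpoly K[n.+1]}) :
  (i <= n.+1)%N -> sact i f = f - alpha K n i *: g -> divdiff i f = g.
Proof.
move=> le E; apply: (hscaleI (alpha_neq0 K le)); rewrite divdiffP // E.
by rewrite opprB addrC subrK.
Qed.

Lemma eq_params_qsum (F : fieldType) (v v' : nat -> F) la s :
  v =1 v' -> qsum v la s = qsum v' la s.
Proof.
move=> vv; apply: eq_qsum => k x _; congr (_ * _).
by apply: eq_bigr => i _; rewrite vv.
Qed.

Lemma hcomp_sum (R : comNzRingType) (I : Type) (s : seq I) (f : I -> hLambda R) k M :
  (\sum_(i <- s) f i) k M = \sum_(i <- s) f i k M.
Proof. by apply: (big_morph (fun h : hLambda R => h k M)). Qed.

Lemma hscaleAr (R : comNzRingType) (c : R) (f g : hLambda R) :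
  f * (c *: g) = c *: (f * g).
Proof.
apply: hLambdaP => k M /=; rewrite scaler_sumr.
by apply: eq_bigr => i _; rewrite scalerAr.
Qed.

Lemma hmul_trunc (R : comNzRingType) (f g h : hLambda R) k M :
  (forall i, (i <= k)%N -> g i M = h i M) -> (f * g) k M = (f * h) k M.
Proof. by move=> gh; apply: eq_bigr => i _; rewrite gh ?leq_subr. Qed.

Lemma map_mpoly_inj (R R' : comNzRingType) (phi : {rmorphism R -> R'}) N :
  injective phi -> injective (map_mpoly phi : {mpoly R[N]} -> {mpoly R'[N]}).
Proof.
move=> phiI p q /mpolyP E; apply/mpolyP => m; apply: phiI.
by have := E m; rewrite !mcoeff_map_mpoly.
Qed.

Lemma strict_part_swap (j : nat) mu : strict_part mu -> ~~ ((j.+2 \in mu) && (j.+1 \in mu)) ->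
  strict_part (map (swapn j.+1) mu).
Proof.
move=> /andP[st mu0] ne; apply/andP; split; last first.
  apply: contra mu0 => /mapP[k kmu]; rewrite /swapn; do 2?case: eqP => //.
  by move=> _ _ k0; rewrite k0.
apply: (homo_sorted_in (P := mem mu)) st; last exact/allP.
move=> x y xmu ymu /=; rewrite /swapn.
case: (eqVneq x j.+1) xmu => [->|xj] xmu; case: (eqVneq y j.+1) ymu => [->|yj] ymu.
- by rewrite !ltnn.
- by case: eqP => // ? ?; lia.
- case: eqP xmu => [->|? _ ?]; last lia.
  by move=> H; case/negP: ne; apply/andP; split.
- case: eqP => ?; case: eqP => ? ?; lia.
Qed.

Lemma mem_map_swap (j k : nat) mu : (k \in map (swapn j) mu) = (swapn j k \in mu).
Proof. by rewrite -{1}(swapnK j k) mem_map //; exact: inv_inj (swapnK j). Qed.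

Lemma map_swapK (j : nat) : involutive (map (swapn j)).
Proof. by move=> mu; rewrite -map_comp map_id_in // => k _ /=; rewrite swapnK. Qed.

(** * The Cauchy identity and the action on dual factorial P-functions *)

Section FlipParams.
Variables (F : fieldType) (a : nat -> F).
Hypotheses (a_inj : injective a) (a_add : forall i j, a i + a j != 0).

Lemma flip0_inj : injective (flip0 a).
Proof.
move=> i l; rewrite /flip0; case: eqP => [->|i0]; case: eqP => [->|l0] // E.
- by have := a_add 0 l; rewrite -E subrr eqxx.
- by have := a_add 0 i; rewrite E subrr eqxx.
- exact: a_inj.
Qed.

Lemma flip0_add i l : flip0 a i + flip0 a l != 0.
Proof.
rewrite /flip0; case: (i =P 0%N) => [_|/eqP i0]; case: (l =P 0%N) => [_|/eqP l0].
- by rewrite -opprD oppr_eq0 a_add.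
- by rewrite addrC subr_eq0 (inj_eq a_inj).
- by rewrite subr_eq0 (inj_eq a_inj).
- exact: a_add.
Qed.

Lemma flip0_neq i : flip0 a i != a 0%N.
Proof.
rewrite /flip0; case: (i =P 0%N) => [_|/eqP i0]; last by rewrite (inj_eq a_inj).
by rewrite eq_sym -subr_eq0 opprK a_add.
Qed.
End FlipParams.

Section Cauchy.
Variables (K : numFieldType) (P : seq nat -> hLambda (cpoly K)).
Hypothesis PP : dual_factorial_P P.
Local Notation A := (cpoly K).

Lemma cpoly_nat_unit k : exists u : A, u * k.+1%:R = 1.
Proof.
exists (k.+1%:R^-1)%:A; rewrite mulr_natr -scaler_nat scalerA divff ?scale1r //.
by rewrite pnatr_eq0.
Qed.

(** On the left f does not appear: one and the same kernel is expanded for every choice of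
    parameters, which is what makes two expansions comparable. *)
Lemma cauchy_at (F : fieldType) (f : {rmorphism A -> F}) k (s : seq (seq nat)) (xs : seq F) M :
  (forall N M, (\prod_(i < N) omega ('X_i : {mpoly A[N]})) k M =
     \sum_(la <- s) factQ (@avar K) la N *: map_mpoly (@mpolyC N A) (P la k M)) ->
  uniq xs ->
  (\prod_(x <- xs) omega x) k M =
  (\sum_(la <- s) qsum (f \o @avar K) la xs *: hmap f (P la)) k M.
Proof.
move=> C Ux; pose N := size xs.
pose g : {rmorphism {mpoly A[N]} -> F} := mmap f (fun i : 'I_N => xs`_i).
have gX i : g 'X_i = xs`_i by rewrite /g /= mmapX mmap1U.
have gC c : g c%:MP = f c by rewrite /g /= mmapC.
have g_inj : injective (fun i => g 'X_i).
  by move=> i j; rewrite !gX => /eqP; rewrite nth_uniq // => /eqP /val_inj.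
have xsE : [seq g 'X_i | i <- enum 'I_N] = xs.
  rewrite (eq_map gX) (map_comp (fun i => xs`_i) val) val_enum_ord.
  exact: mkseq_nth.
have := congr1 (map_mpoly g) (C N M).
have -> : map_mpoly g ((\prod_(i < N) omega ('X_i : {mpoly A[N]})) k M) =
    (\prod_(x <- xs) omega x) k M.
  rewrite -[LHS]/(hmap g _ k M) rmorph_prod (big_nth 0) big_mkord.
  by congr (hcomp _ k M); apply: eq_bigr => i _; rewrite /= hmap_omega gX.
move=> ->; rewrite hcomp_sum rmorph_sum; apply: eq_bigr => la _.
rewrite /= map_mpolyZ_rmorph eval_factQ //; last exact: cpoly_nat_unit.
rewrite xsE; congr (_ *: _); first by apply: eq_params_qsum => i /=; rewrite gC.
by apply/mpolyP => m; rewrite !mcoeff_map_mpoly /= gC.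
Qed.

Lemma cauchy_support k : exists s : seq (seq nat),
  [/\ uniq s, all strict_part s,
      forall la i M, (i <= k)%N -> strict_part la -> la \notin s -> P la i M = 0
    & forall i (F : fieldType) (f : {rmorphism A -> F}) (xs : seq F) M, (i <= k)%N -> uniq xs ->
      (\prod_(x <- xs) omega x) i M =
      (\sum_(la <- s) qsum (f \o @avar K) la xs *: hmap f (P la)) i M].
Proof.
have ext i (s t : seq (seq nat)) (F : fieldType) (f : {rmorphism A -> F}) (xs : seq F) M :
    uniq s -> uniq t -> {subset s <= t} -> all strict_part t ->
    (forall la M, strict_part la -> la \notin s -> P la i M = 0) ->
    (\sum_(la <- s) qsum (f \o @avar K) la xs *: hmap f (P la)) i M =
    (\sum_(la <- t) qsum (f \o @avar K) la xs *: hmap f (P la)) i M.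
  move=> Us Ut st strt van; rewrite !hcomp_sum [RHS](bigID (mem s)) /=.
  rewrite [X in _ + X]big_seq_cond [X in _ + X]big1 ?addr0 => [|la /andP[lat las]].
    rewrite -[RHS]big_filter; apply: perm_big; apply: uniq_perm => //.
      by rewrite filter_uniq.
    by move=> la; rewrite mem_filter; case las: (la \in s) => //=; rewrite st.
  by rewrite /= van ?rmorph0 ?scaler0 //; exact: (allP strt).
elim: k => [|k [s [Us strs van C]]].
  have [_ /(_ 0%N)[s [Us strs van C]]] := PP; exists s; split=> //.
    by move=> la i M; rewrite leqn0 => /eqP ->; exact: van.
  by move=> i F f xs M; rewrite leqn0 => /eqP -> Ux; exact: cauchy_at.
have [_ /(_ k.+1)[s' [Us' strs' van' C']]] := PP.
pose t := undup (s ++ s').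
have Ut : uniq t by exact: undup_uniq.
have sub : {subset s <= t} by move=> la las; rewrite mem_undup mem_cat las.
have sub' : {subset s' <= t} by move=> la las; rewrite mem_undup mem_cat las orbT.
have strt : all strict_part t.
  by apply/allP => la; rewrite mem_undup mem_cat => /orP[/(allP strs)|/(allP strs')].
exists t; split=> // [la i M|i F f xs M].
  rewrite leq_eqVlt => /predU1P[->|lt] sla nla.
    by apply: van' => //; apply: contra nla; exact: sub'.
  by apply: van => //; apply: contra nla; exact: sub.
rewrite leq_eqVlt => /predU1P[->|lt] Ux.
  by rewrite -(@ext _ s') //; exact: cauchy_at.
rewrite -(@ext _ s) //; first exact: C.
by move=> la M'; exact: van.
Qed.

Let ev (v : nat -> K) : {rmorphism A -> K} := asubst idfun v.

Let evE v i : ev v (avar K i) = v i.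
Proof. exact: asubst_avar. Qed.

Lemma avar_inj : injective (@avar K).
Proof.
move=> i j ij; pose v k : K := (k == i)%:R.
have : v i = v j := etrans (esym (evE v i)) (etrans (congr1 (ev v) ij) (evE v j)).
by rewrite /v eqxx {ij}; case: (eqVneq j i) => // _ /eqP; rewrite oner_eq0.
Qed.

Lemma avar_add i j : avar K i + avar K j != 0.
Proof.
pose v (k : nat) : K := 1; apply/eqP => ij.
have E : v i + v j = 0.
  transitivity (ev v (avar K i) + ev v (avar K j)); first by congr (_ + _); exact/esym/evE.
  by rewrite -rmorphD ij {ij} rmorph0.
by move/eqP: E; rewrite /v -mulr2n {ij} pnatr_eq0.
Qed.

Section Fractions.
Variables (F : fieldType) (tf : {rmorphism A -> F}).
Hypothesis tf_inj : injective tf.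
Let a : nat -> F := tf \o @avar K.

(** With no variable x the kernel is 1, and only the Q-function of the empty partition is
    nonzero. *)
Lemma P_nil : P [::] = 1.
Proof.
apply: hLambdaP => k M; have [s [Us strs van C]] := cauchy_support k.
have := C k _ tf [::] M (leqnn k) isT; rewrite big_nil hcomp_sum.
have Qnil la : la != [::] -> qsum (tf \o @avar K) la [::] = 0.
  by case: la => //= p la _; rewrite big_nil.
move=> E; apply: (map_mpoly_inj tf_inj).
rewrite -[RHS]/(hmap tf 1 k M) rmorph1 E.
have [ns|ns] := boolP ([::] \in s).
  rewrite (bigD1_seq [::]) //= big1 ?addr0 ?scale1r // => la /Qnil ->.
  by rewrite scale0r.
rewrite van // rmorph0 big_seq big1 // => la las /=.
by rewrite Qnil ?scale0r //; apply: contraNneq ns => <-.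
Qed.
Let a_inj : injective a.
Proof. by move=> i j /tf_inj /avar_inj. Qed.

Let a_add i j : a i + a j != 0.
Proof. by rewrite /a /= -rmorphD -(rmorph0 tf) (inj_eq tf_inj) avar_add. Qed.

Let two : (2 : F) != 0.
Proof.
by apply: contraNneq (a_add 0 0) => two0; rewrite -mulr2n -mulr_natl two0 mul0r.
Qed.

Let pts_uniq (v : nat -> F) mu : injective v -> strict_part mu ->
  uniq [seq v m.-1 | m <- mu].
Proof.
move=> v_inj smu; rewrite map_inj_in_uniq; first exact: strict_part_uniq.
have /andP[_ mu0] := smu.
move=> m m' mmu mmu' /v_inj E.
have : m != 0%N by apply: contraNneq mu0 => <-.
have : m' != 0%N by apply: contraNneq mu0 => <-.
lia.
Qed.

Let coefs (f : {rmorphism A -> F}) (s : seq (seq nat)) xs k M mm :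
  ((\sum_(la <- s) qsum (f \o @avar K) la xs *: hmap f (P la)) k M)@_mm =
  \sum_(la <- s) f ((P la k M)@_mm) * qsum (f \o @avar K) la xs.
Proof.
rewrite hcomp_sum raddf_sum; apply: eq_bigr => la _ /=.
by rewrite mcoeffZ mcoeff_map_mpoly mulrC.
Qed.

Let aswap_frac j : {rmorphism A -> F} := tf \o aswap j.

(** In [qsum_transfer], c' belongs to the parameters a and c to the swapped ones. The move j+2 ->
    j+1 on the index of Q dualizes to j+1 -> j+2 on the index of P. *)
Lemma P_swap j mu : strict_part mu ->
  P mu = hmap (aswap j) (P mu) +
    (if (j.+1 \in mu) && (j.+2 \notin mu)
     then (avar K j - avar K j.+1) *: hmap (aswap j) (P (map (swapn j.+1) mu)) else 0).
Proof.
move=> smu; apply: hLambdaP => k M; have [s [Us strs van C]] := cauchy_support k.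
apply: (map_mpoly_inj tf_inj); apply/mpolyP => mm; rewrite !mcoeff_map_mpoly /=.
pose c la := aswap_frac j ((P la k M)@_mm).
pose c' la := tf ((P la k M)@_mm).
pose D (la : seq nat) := (j.+2 \in la) && (j.+1 \notin la).
pose U (la : seq nat) := (j.+1 \in la) && (j.+2 \notin la).
pose sw := map (swapn j.+1).
have swU la : U (sw la) = D la by rewrite /U /D !mem_map_swap swapnL swapnR.
have swD la : D (sw la) = U la by rewrite /U /D !mem_map_swap swapnL swapnR.
have swS la : strict_part la -> D la || U la -> strict_part (sw la).
  move=> sla H; apply: strict_part_swap => //; move: H; rewrite /D /U.
  by case: (j.+2 \in la); case: (j.+1 \in la).
have T : c' mu = c mu + if U mu then (a j - a j.+1) * c (sw mu) else 0.
  apply: (qsum_transfer a_inj a_add Us strs (D := D) (dn := sw)) smu.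
  - by move=> la sla nla; rewrite /c /c' van // mcoeff0 !rmorph0.
  - by move=> la sla Dl; rewrite swU /sw map_swapK swS ?Dl.
  - by move=> la sla Ul; rewrite swD /sw map_swapK swS ?Ul ?orbT.
  move=> nu snu; set xs := [seq _ | m <- nu].
  have Uxs : uniq xs by exact: pts_uniq.
  transitivity ((\prod_(x <- xs) omega x) k M)@_mm.
    by rewrite (C _ _ tf) // coefs.
  rewrite (C _ _ (aswap_frac j)) // coefs big_seq [RHS]big_seq.
  apply: eq_bigr => la las; congr (_ * _).
  rewrite -qsum_swap //; last exact: (allP strs).
  apply: eq_params_qsum => i; rewrite /a /aswap_frac /=; congr (tf _).
  exact: asubst_avar.
rewrite -[LHS]/(c' mu) T mcoeffD rmorphD; congr (_ + _); first by rewrite mcoeff_map_mpoly.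
rewrite -/(U mu); case: ifP => _; last by rewrite mcoeff0 rmorph0.
by rewrite /= mcoeffZ rmorphM rmorphB mcoeff_map_mpoly.
Qed.

Lemma P_swap_fixed j mu : strict_part mu -> (j.+1 \notin mu) || (j.+2 \in mu) ->
  hmap (aswap j) (P mu) = P mu.
Proof.
move=> smu H; rewrite [RHS](P_swap j) // ifF ?addr0 //.
by move: H; case: (j.+1 \in mu); case: (j.+2 \in mu).
Qed.

(** The partition with the box added contains j+2 but not j+1, so its P is fixed by the swap and
    [P_swap] can be solved. *)
Lemma P_swap_up j mu : strict_part mu -> j.+1 \in mu -> j.+2 \notin mu ->
  hmap (aswap j) (P mu) = P mu - (avar K j - avar K j.+1) *: P (map (swapn j.+1) mu).
Proof.
move=> smu H1 H2; rewrite {2}(P_swap j smu) H1 H2 /=.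
rewrite (@P_swap_fixed j (map (swapn j.+1) mu)) ?addrK //.
  by apply: strict_part_swap; rewrite // (negPf H2).
by rewrite !mem_map_swap swapnR H1 orbT.
Qed.

Lemma strict_part_rcons1 la : strict_part la -> 1%N \in la ->
  exists2 la', la = rcons la' 1%N & all (leq 2) la'.
Proof.
elim/last_ind: la => // la p _ /andP[st]; rewrite mem_rcons inE negb_or => /andP[p0 la0].
have gtp q : q \in la -> (p < q)%N.
  move=> qla; move: st; rewrite (sorted_pairwise (rev_trans ltn_trans)) -cats1.
  by rewrite pairwise_cat => /and3P[/allrelP H _ _]; apply: H; rewrite ?mem_head.
rewrite mem_rcons inE => /orP[/eqP pE|/gtp]; last by case: p p0 {st gtp}.
by exists la; [rewrite pE | apply/allP => q /gtp; rewrite -pE].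
Qed.

Lemma strict_part_gt1 la : strict_part la -> 1%N \notin la -> all (leq 2) la.
Proof.
move=> /andP[_ la0] la1; apply/allP => -[|[|k]] //.
  by rewrite (negPf la0).
by rewrite (negPf la1).
Qed.

Lemma strict_rcons1 la : strict_part la -> all (leq 2) la -> strict_part (rcons la 1%N).
Proof.
move=> /andP[st la0] la2; apply/andP; split; last by rewrite mem_rcons inE.
move: st; rewrite !(sorted_pairwise (rev_trans ltn_trans)) -cats1 pairwise_cat => ->.
by rewrite /= !andbT; apply/allrelP => x y xla; rewrite inE => /eqP ->; exact: (allP la2).
Qed.

Definition aflip : A -> A := asubst (in_alg A) (flip0 (@avar K)).
HB.instance Definition _ := GRing.RMorphism.on aflip.

(** The kernel at the points a_1, xs is Omega(a_1|y) times the kernel at xs. The first is expanded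
    with parameters a, the second with a_1 negated, and adjoining the point a_1 relates the two
    families of Q. *)
Lemma P_flip mu : strict_part mu -> 1%N \notin mu ->
  omega (avar K 0) * hmap aflip (P mu) = P mu + (2 * avar K 0) *: P (rcons mu 1%N).
Proof.
move=> smu mu1; apply: hLambdaP => k M; have [s [Us strs van C]] := cauchy_support k.
apply: (map_mpoly_inj tf_inj); apply/mpolyP => mm; rewrite !mcoeff_map_mpoly /=.
pose fl : {rmorphism A -> F} := tf \o aflip.
pose v := flip0 a.
have flE : fl \o avar K =1 v.
  move=> i /=; rewrite /aflip /v /flip0 asubst_avar /=.
  by case: ifP => // _; rewrite rmorphN.
have v_inj : injective v by exact: flip0_inj.
have v_add : forall i l, v i + v l != 0 by exact: flip0_add.
pose O := omega (avar K 0).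
have OE la : hmap tf (O * hmap aflip (P la)) = omega (a 0%N) * hmap fl (P la).
  by rewrite rmorphM /= hmap_omega (hmap_comp (chi := fl)).
pose c' la := tf ((O * hmap aflip (P la)) k M)@_mm.
pose c la := tf ((P la k M)@_mm).
pose D (la : seq nat) := 1%N \in la.
pose U (la : seq nat) := 1%N \notin la.
pose dn (la : seq nat) := [seq m <- la | m != 1%N].
have dn_rcons la : all (leq 2) la -> dn (rcons la 1%N) = la.
  by move=> la2; rewrite /dn filter_rcons eqxx /=; apply/all_filterP; apply: sub_all la2 => -[|[]].
have T : c' mu = c mu + if U mu then 2 * a 0%N * c (rcons mu 1%N) else 0.
  apply: (@qsum_transfer F v _ _ s c c' _ D U dn (fun la => rcons la 1%N)) smu => //.
  - move=> la sla nla; rewrite /c /c' van // mcoeff0 !rmorph0; split=> //.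
    rewrite (@hmul_trunc _ O (hmap aflip (P la)) 0) ?mulr0 /= ?mcoeff0 ?rmorph0 // => i le.
    by rewrite /= van ?rmorph0.
  - move=> la sla Dl; have [la' laE la2] := strict_part_rcons1 sla Dl.
    move: sla; rewrite laE dn_rcons // /U => /andP[st la0]; split=> //.
      move: st la0; rewrite mem_rcons inE negb_or => + /andP[_ la0].
      rewrite /strict_part la0 !(sorted_pairwise (rev_trans ltn_trans)) -cats1.
      by rewrite pairwise_cat => /and3P[_ ->].
    by apply/negP => /(allP la2).
  - move=> la sla Ul; have la2 := strict_part_gt1 sla Ul.
    by rewrite dn_rcons // strict_rcons1 // /D mem_rcons mem_head.
  move=> nu snu; set xs := [seq _ | m <- nu].
  have Uxs : uniq xs by exact: pts_uniq.
  (* The test points are values of the flipped parameters, among which a_1 does not occur, so it is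
     a new point. *)
  have axs : a 0%N \notin xs by apply/mapP => -[m _ E]; have := flip0_neq a_inj a_add m.-1; rewrite -/v -E eqxx.
  transitivity ((omega (a 0%N) * \prod_(x <- xs) omega x) k M)@_mm; last first.
    have Uaxs : uniq (a 0%N :: xs) by rewrite /= axs.
    have -> : omega (a 0%N) * \prod_(x <- xs) omega x = \prod_(x <- a 0%N :: xs) omega x.
      by rewrite big_cons.
    rewrite (C _ _ tf) // coefs big_seq [RHS]big_seq.
    apply: eq_bigr => la las; congr (_ * _); have sla := allP strs _ las.
    rewrite /D; case: ifP => la1.
      have [la' -> la2] := strict_part_rcons1 sla la1.
      by rewrite qsum_flip0_rcons ?dn_rcons.
    by rewrite addr0 qsum_flip0 // strict_part_gt1 ?la1.
  have E i : (i <= k)%N -> (\prod_(x <- xs) omega x) i M =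
      (\sum_(la <- s) qsum v la xs *: hmap fl (P la)) i M.
    move=> le; rewrite (C _ _ fl) //; congr (hcomp _ i M); apply: eq_bigr => la _.
    by congr (_ *: _); exact: eq_params_qsum.
  have scE (q : F) (h : hLambda F) : (q *: h) k M = q *: h k M by [].
  have E2 la : c' la * qsum v la xs =
      ((omega (a 0%N) * (qsum v la xs *: hmap fl (P la))) k M)@_mm.
    by rewrite hscaleAr -OE scE mcoeffZ mcoeff_hmap mulrC.
  rewrite (hmul_trunc _ E) mulr_sumr hcomp_sum raddf_sum; apply: eq_bigr => la _.
  exact: E2.
rewrite -[LHS]/(c' mu) T mcoeffD rmorphD; congr (_ + _).
by rewrite /U mu1 mcoeffZ !rmorphM rmorph_nat.
Qed.

End Fractions.
End Cauchy.

(** * Dual factorial P-functions with specialized parameters *)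

Section Specialization.
Variables (K : numFieldType) (P : seq nat -> hLambda (cpoly K)).
Hypothesis PP : dual_factorial_P P.
Variables (S : comNzRingType) (f : {rmorphism K -> S}).
Implicit Types (v : nat -> S) (mu : seq nat).
Local Notation A := (cpoly K).

(** The identities for P, obtained by evaluation in a field containing C[a], are used here with its
    fraction field. *)
Let tf : {rmorphism A -> {fraction A}} := @FracField.tofrac _.

Let tf_inj : injective tf.
Proof. by move=> x y /eqP; rewrite tofrac_eq => /eqP. Qed.

Definition Psub v mu := hmap (asubst f v) (P mu).

Lemma Psub_swapE v j mu :
  Psub (v \o swapn j) mu = hmap (asubst f v) (hmap (aswap j) (P mu)).
Proof. by rewrite (hmap_comp _ (asubst_aswap f v j)). Qed.

Lemma Psub_swap_fixed v j mu : strict_part mu -> (j.+1 \notin mu) || (j.+2 \in mu) ->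
  Psub (v \o swapn j) mu = Psub v mu.
Proof. by move=> smu H; rewrite Psub_swapE (P_swap_fixed PP tf_inj). Qed.

Lemma Psub_swap_up v j mu : strict_part mu -> j.+1 \in mu -> j.+2 \notin mu ->
  Psub (v \o swapn j) mu =
  Psub v mu - (v j - v j.+1) *: Psub v (map (swapn j.+1) mu).
Proof.
move=> smu H1 H2; rewrite Psub_swapE (P_swap_up PP tf_inj) // rmorphB /= hmapZ.
congr (_ - _ *: _).
by rewrite rmorphB; congr (_ - _); exact: asubst_avar.
Qed.

Lemma Psub_flip v mu : strict_part mu -> 1%N \notin mu ->
  omega (v 0%N) * Psub (flip0 v) mu = Psub v mu + (2 * v 0%N) *: Psub v (rcons mu 1%N).
Proof.
move=> smu H; have flE p : asubst f v (aflip p) = asubst f (flip0 v) p.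
  rewrite asubst_comp; apply: eq_asubst => i; rewrite /flip0.
  by case: ifP => _; rewrite ?rmorphN /= asubst_avar.
rewrite /Psub -(hmap_comp _ flE).
have -> : omega (v 0%N) = hmap (asubst f v) (omega (avar K 0)).
  by rewrite hmap_omega /= asubst_avar.
rewrite -rmorphM (P_flip PP tf_inj) // rmorphD /= hmapZ rmorphM /= rmorph_nat.
by rewrite asubst_avar.
Qed.

(** For j >= m, j+1 exceeds every part, so [aswap j] fixes P_mu; invariance under all these swaps
    removes the later parameters. *)
Lemma Psub_dep v v' m mu : strict_part mu -> all (geq m) mu ->
  (forall i, (i < m)%N -> v i = v' i) -> Psub v mu = Psub v' mu.
Proof.
move=> smu lem vv; apply: hLambdaP => k M; apply/mpolyP => mm; rewrite !mcoeff_hmap.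
apply: (@asubst_swap_inv _ _ f _ m _ _ _ vv) => j le_mj.
rewrite -(mcoeff_hmap (aswap j)) (P_swap_fixed PP tf_inj) //.
by apply/orP; left; apply/negP => /(allP lem) /=; rewrite leqNgt ltnS le_mj.
Qed.

Lemma Psub_nil v : Psub v [::] = 1.
Proof. by rewrite /Psub (P_nil PP tf_inj) rmorph1. Qed.
End Specialization.

Lemma swapnC j k x : (j.+1 < k)%N -> swapn j (swapn k x) = swapn k (swapn j x).
Proof.
move=> lt; rewrite /swapn.
case: (x =P j) => ?; case: (x =P j.+1) => ?; case: (x =P k) => ?;
  case: (x =P k.+1) => ?; try lia; repeat case: eqP => ?; lia.
Qed.

(** * The parameters a^(n) *)

Section Periodic.
Variables (K : numFieldType) (n : nat).
Local Notation r := n.+1.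
Local Notation S := {mpoly K[n.+1]}.
Local Notation a := (@aper K n).

Lemma aper_low j : (j < r)%N -> a j = 'X_(inord j).
Proof. by move=> lt; rewrite /aper modn_small ?lt //; lia. Qed.

Lemma aper_high j : (r <= j < r.*2)%N -> a j = - 'X_(inord (r.*2.-1 - j)).
Proof.
by move=> /andP[le lt]; rewrite /aper modn_small // ltnNge le.
Qed.

Lemma tperm_inord i k : (i.+1 < r)%N -> (k < r)%N ->
  tperm (inord i) (inord i.+1) (inord k) = inord (swapn i k) :> 'I_r.
Proof.
move=> lt_i lt_k; rewrite /swapn.
have inj p q : (p < r)%N -> (q < r)%N -> inord p = inord q :> 'I_r -> p = q.
  by move=> lp lq /(congr1 val); rewrite /= !inordK.
case: eqP => [->|/eqP ki]; first by rewrite tpermL.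
case: eqP => [->|/eqP ki']; first by rewrite tpermR.
rewrite tpermD //; apply/eqP => /inj E; have := E; lia.
Qed.

(** Counting from 0, the entries 2r-1-i and 2r-2-i are the negatives of the entries i and i+1. *)
Lemma sp_act_aper_mid i j : (i.+1 < r)%N -> (j < r.*2)%N ->
  sp_act (srefl n i.+1) (a j) = a (swapn i (swapn (r.*2.-2 - i) j)).
Proof.
move=> lt_i lt_j.
have act k : (k < r)%N -> sp_act (srefl n i.+1) ('X_(inord k) : S) = 'X_(inord (swapn i k)).
  move=> lt_k; rewrite sp_actXU /srefl /= ifF; last by apply/negbTE; lia.
  by rewrite /= ffunE scale1r tperm_inord.
have [lt|le] := ltnP j r.
  have -> : swapn (r.*2.-2 - i) j = j.
    by rewrite /swapn; do 2?case: eqP => //; lia.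
  rewrite aper_low // act // aper_low //.
  by rewrite /swapn; do 2?case: eqP => ?; lia.
rewrite aper_high ?le // rmorphN /= act; last lia.
have -> : swapn i (swapn (r.*2.-2 - i) j) = swapn (r.*2.-2 - i) j.
  by rewrite /swapn; repeat case: eqP; lia.
rewrite aper_high; last by rewrite /swapn; repeat case: eqP; lia.
by congr (- 'X_(inord _)); rewrite /swapn; repeat case: eqP; lia.
Qed.

(** a_r and -a_r are adjacent, so the two mirror swaps coincide. *)
Lemma sp_act_aper_last j : (j < r.*2)%N ->
  sp_act (srefl n r) (a j) = a (swapn n j).
Proof.
move=> lt_j.
have act k : (k < r)%N -> sp_act (srefl n r) ('X_(inord k) : S) =
    if k == n then - 'X_(inord k) else 'X_(inord k).
  move=> lt_k; rewrite sp_actXU /srefl /= eqxx /= ffunE perm1.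
  have -> : (inord k == ord_max :> 'I_r) = (k == n) by rewrite -val_eqE /= inordK.
  by case: ifP => _; rewrite ?expr1 ?scaleN1r ?scale1r.
have [lt|le] := ltnP j r.
  rewrite aper_low // act // /swapn; case: eqP => [->|jn].
    by rewrite aper_high; [congr (- 'X_(inord _))|]; lia.
  by rewrite ifF ?aper_low //; apply/negbTE; lia.
rewrite aper_high ?le // rmorphN /= act; last lia.
have jn : (j == n) = false by apply/negbTE; lia.
rewrite /swapn jn; case: (eqVneq j r) => [->|jr].
  rewrite ifT ?opprK ?aper_low //; last by apply/eqP; lia.
  by congr ('X_(inord _)); lia.
by rewrite ifF ?aper_high ?le //; apply/negbTE; lia.
Qed.

(** s_0 also negates the entry -a_1 that ends the period, which [flip0] does not; the bound on j
    excludes it. *)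
Lemma sp_act_aper_first j : (j < r.*2.-1)%N ->
  sp_act (srefl n 0) (a j) = flip0 a j.
Proof.
move=> lt_j.
have act k : (k < r)%N -> sp_act (srefl n 0) ('X_(inord k) : S) =
    if k == 0%N then - 'X_(inord k) else 'X_(inord k).
  move=> lt_k; rewrite sp_actXU /srefl /= ffunE perm1.
  have -> : (inord k == ord0 :> 'I_r) = (k == 0%N) by rewrite -val_eqE /= inordK.
  by case: ifP => _; rewrite ?expr1 ?scaleN1r ?scale1r.
rewrite /flip0; have [lt|le] := ltnP j r.
  rewrite aper_low // act //; case: eqP => [->|//].
  by rewrite aper_low.
have j0 : (j == 0%N) = false by apply/negbTE; lia.
rewrite j0 aper_high; last lia.
by rewrite rmorphN /= act ?ifF //; [apply/negbTE|]; lia.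
Qed.

Variable P : seq nat -> hLambda (cpoly K).
Hypothesis PP : dual_factorial_P P.
Local Notation Pa := (Psub P (@mpolyC n.+1 K) a).

Lemma hmap_sp_act w v mu :
  hmap (sp_act w) (Psub P (@mpolyC n.+1 K) v mu) = Psub P (@mpolyC n.+1 K) (sp_act w \o v) mu.
Proof.
apply: hmap_comp => p; apply: rmorph_asubst => c; exact: comp_mpolyC.
Qed.

Lemma leq_sumn k mu : k \in mu -> (k <= sumn mu)%N.
Proof. by elim: mu => //= m mu IH; rewrite inE => /predU1P[->|/IH]; lia. Qed.

Lemma leq_sumn2 k l mu : k != l -> k \in mu -> l \in mu -> (k + l <= sumn mu)%N.
Proof.
elim: mu => //= m mu IH kl; rewrite !inE => /predU1P[km|kmu] /predU1P[lm|lmu].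
- by rewrite km lm eqxx in kl.
- by have := leq_sumn lmu; lia.
- by have := leq_sumn kmu; lia.
- by have := IH kl kmu lmu; lia.
Qed.

Lemma divdiff_first mu : strict_part mu -> (sumn mu < r.*2)%N -> 1%N \notin mu ->
  divdiff 0 (Pa mu) = Pa (rcons mu 1%N).
Proof.
move=> smu lt mu1; apply: divdiffE => //; rewrite /sact /=.
have v0 : a 0%N = 'X_ord0 by rewrite aper_low // -[in RHS](inord_val ord0).
rewrite hmap_sp_act (Psub_dep PP _ (v' := flip0 a) (m := r.*2.-1) smu).
- rewrite -v0 (Psub_flip PP) // /alpha /= v0 scaleNr opprK.
  by rewrite -mul_mpolyC rmorph_nat.
- by apply/allP => k /leq_sumn /=; lia.
- by move=> j; exact: sp_act_aper_first.
Qed.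

Lemma divdiff_up i q mu : (0 < i <= r)%N -> (q == i) || (q + i == r.*2)%N ->
  strict_part mu -> (sumn mu < r.*2)%N -> q \in mu -> q.+1 \notin mu ->
  divdiff i (Pa mu) = Pa (map (swapn q) mu).
Proof.
case: i => // i /=; rewrite ltnS => le_in; case: q => [|q] qi smu lt qmu q1mu.
  by case/andP: smu => _; rewrite qmu.
apply: divdiffE; first lia.
rewrite /sact /= hmap_sp_act.
have mub : all (geq r.*2.-1) mu by apply/allP => k /leq_sumn /=; lia.
(* Either pair of neighbours moved by the reflection differs by the same simple root; for the last
   reflection the pair is a_r, -a_r. *)
have al : a q - a q.+1 = alpha K n i.+1.
  rewrite /alpha /=; case: eqP => [iE|ni].
    have qn : q = n by lia.
    rewrite qn aper_low // aper_high; last lia.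
    rewrite opprK scaler_nat mulr2n; congr ('X_ _ + 'X_ _); apply: val_inj => /=;
      rewrite inordK; lia.
  case/orP: qi => [/eqP [qi]|/eqP qi].
    by rewrite qi !aper_low //; lia.
  rewrite !aper_high; [|lia|lia].
  rewrite opprK addrC; congr ('X_(inord _) - 'X_(inord _)); lia.
rewrite -al -(Psub_swap_up PP) //.
have [iE|ni] := eqVneq i n.
  apply: (Psub_dep PP _ (m := r.*2.-1) smu) => // j lj.
  have -> : q = n by lia.
  by rewrite /= iE sp_act_aper_last //; lia.
(* The mirror swap moves only the part complementary to the present one; together they would sum to
   2r, more than the size of mu. *)
pose q' := (r.*2.-2 - q)%N.
rewrite -(@Psub_swap_fixed _ _ PP _ _ (a \o swapn q) q') //; last first.
  apply/orP; left; apply/negP => q'mu; have := leq_sumn2 _ q'mu qmu; lia.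
apply: (Psub_dep PP _ (m := r.*2.-1) smu) => // j lj /=.
rewrite sp_act_aper_mid; [|lia|lia].
congr (aper _ _ _); rewrite /q'; case/orP: qi => [/eqP [->] //|/eqP qi].
have -> : q = (r.*2.-2 - i)%N by lia.
have -> : (r.*2.-2 - (r.*2.-2 - i) = i)%N by lia.
by apply: swapnC; lia.
Qed.
End Periodic.

(** * The affine Weyl group *)

Section WeylGroup.
Variable n : nat.
Local Notation r := n.+1.
Local Notation vec := {ffun 'I_r -> int}.

(** The affine action on the coweight lattice. It is faithful, so relations between words are
    checked on coordinates. *)
Definition waf_act (x : waf r) (mu : vec) : vec := waf_tr x + sp_cow (waf_fin x) mu.

Lemma waf_actM x y mu : waf_act (x * y)%g mu = waf_act x (waf_act y mu).
Proof. by rewrite /waf_act /= sp_cowM sp_cowD addrA. Qed.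

Lemma waf_act1 mu : waf_act 1%g mu = mu.
Proof. by rewrite /waf_act /= sp_cow1 add0r. Qed.

Lemma waf_act_faithful x y : waf_act x =1 waf_act y -> x = y.
Proof.
case: x y => [t [e s]] [t' [e' s']] E.
have tt : t = t' by have := E 0; rewrite /waf_act !sp_cow0 !addr0.
have {}E mu : sp_cow (SPerm e s) mu = sp_cow (SPerm e' s') mu.
  by have := E mu; rewrite /waf_act tt /= => /addrI.
pose eps (j : 'I_r) : vec := [ffun k => (k == j)%:R].
have Ej j : s j = s' j /\ e j = e' j.
  have := congr1 (fun f : vec => f (s j)) (E (eps j)); rewrite !ffunE /= permK eqxx mulr1.
  case: eqP => [sj|_]; last by rewrite mulr0; case: (e j).
  rewrite sj mulr1; have -> : s j = s' j by rewrite -{2}sj permKV.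
  by case: (e j); case: (e' j).
congr Waf => //; congr SPerm; first by apply/ffunP => j; case: (Ej j).
by apply/permP => j; case: (Ej j).
Qed.

(** Coordinates are indexed by nat rather than by ordinals, which leaves the index arithmetic to
    [lia]. *)
Definition refl_act (i : nat) (m : nat -> int) : nat -> int :=
  if i == 0%N then fun k => if k == 0%N then 1 - m 0%N else m k
  else if i == r then fun k => if k == n then - m k else m k
  else fun k => m (swapn i.-1 k).

Definition coord (mu : vec) (k : nat) : int := if (k < r)%N then mu (inord k) else 0.

Lemma coord_inj : injective coord.
Proof.
move=> mu nu E; apply/ffunP => j; have := congr1 (fun f => f (val j)) E.
by rewrite /coord ltn_ord inord_val.
Qed.

Lemma coord_act i mu : (i <= r)%N -> coord (waf_act (sgen n i) mu) = refl_act i (coord mu).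
Proof.
move=> le_i; apply/funext => k; rewrite /coord /refl_act /waf_act /sgen /= /srefl.
have inord_eq p q : (p < r)%N -> (q < r)%N -> (inord p == inord q :> 'I_r) = (p == q).
  by move=> lp lq; rewrite -val_eqE /= !inordK.
have [_|i0] := eqVneq i 0%N.
  case: ltnP => lk; last by case: eqP => // k0; rewrite k0 in lk.
  rewrite !ffunE /= invg1 perm1 ?ffunE -[ord0]/(0 : 'I_r).
  have -> : (inord k == 0 :> 'I_r) = (k == 0%N) by rewrite -val_eqE /= inordK.
  case: eqP => [->|_] /=; last by rewrite add0r mul1r.
  by rewrite mulN1r.
have [_|ir] := eqVneq i r.
  case: ltnP => lk; last by rewrite if_same.
  rewrite !ffunE /= invg1 perm1 ?ffunE add0r.
  have -> : (inord k == ord_max :> 'I_r) = (k == n) by rewrite -val_eqE /= inordK.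
  by case: eqP => _ /=; rewrite ?mulN1r ?mul1r.
have lt1 : (i.-1 < r)%N by lia.
have lt2 : (i < r)%N by lia.
have iE : i.-1.+1 = i by lia.
rewrite /swapn iE; case: ltnP => lk; last by rewrite !ifF //; apply/negbTE; lia.
rewrite !ffunE /= ?ffunE mul1r add0r tpermV.
case: (k =P i.-1) => [->|ki]; first by rewrite tpermL lt2.
case: (k =P i) => [->|ki']; first by rewrite tpermR lt1.
by rewrite lk tpermD // inord_eq //; apply/eqP; lia.
Qed.

Definition word_act (s : seq nat) (m : nat -> int) := foldr refl_act m s.

Lemma wprod_cat s t : wprod n (s ++ t) = (wprod n s * wprod n t)%g.
Proof. exact: big_cat. Qed.

Lemma wprod_cons i s : wprod n (i :: s) = (sgen n i * wprod n s)%g.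
Proof. exact: big_cons. Qed.

Lemma wprod1 i : wprod n [:: i] = sgen n i.
Proof. exact: big_seq1. Qed.

Lemma word_act_cat s t m : word_act (s ++ t) m = word_act s (word_act t m).
Proof. exact: foldr_cat. Qed.

Lemma coord_wprod s mu : all (leq^~ r) s ->
  coord (waf_act (wprod n s) mu) = word_act s (coord mu).
Proof.
elim: s => [|i s IH] /=; first by rewrite /wprod big_nil waf_act1.
by move=> /andP[le_i les]; rewrite wprod_cons waf_actM coord_act // IH.
Qed.

Lemma wprod_eq s t : all (leq^~ r) s -> all (leq^~ r) t ->
  (forall m, word_act s m = word_act t m) -> wprod n s = wprod n t.
Proof.
move=> les let_ E; apply: waf_act_faithful => mu; apply: coord_inj.
by rewrite !coord_wprod.
Qed.

Lemma refl_actK i m : (i <= r)%N -> refl_act i (refl_act i m) = m.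
Proof.
move=> le; apply/funext => k; rewrite /refl_act.
case: (eqVneq i 0%N) => _; first by case: eqP => [->|//]; rewrite /= opprB addrC subrK.
case: (eqVneq i r) => _; first by case: eqP => // _; rewrite opprK.
by rewrite swapnK.
Qed.

(* The position on which rho_p acts and the index of the reflection turning
   rho_p into rho_(p+1). *)
Definition rpos (p : nat) : nat := if (p <= r)%N then p else (r.*2.+1 - p)%N.
Definition rstep (p : nat) : nat := if (p <= r)%N then p else (r.*2 - p)%N.

Lemma rhoS p : (0 < p < r.*2)%N -> rho n p.+1 = rstep p :: rho n p.
Proof.
move=> /andP[p0 lt]; rewrite /rho /rstep; case: (ltngtP p r) => pr.
- by rewrite -[p.+1]addn1 iotaD rev_cat.
- have -> : (p.+1 - r.+1 = (p - r.+1).+1)%N by lia.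
  have -> : (r.*2.+1 - p.+1 = r.*2 - p)%N by lia.
  by rewrite /=; congr (_ :: iota _ _ ++ _); lia.
- have iotaS q : iota 0 q.+1 = iota 0 q ++ [:: q] by rewrite -[q.+1]addn1 iotaD.
  by rewrite pr subnn [iota _ 0]/= cat0s [in LHS]iotaS rev_cat.
Qed.

Lemma rho1 : rho n 1 = [:: 0%N].
Proof. by []. Qed.

Lemma size_rho p : (0 < p <= r.*2)%N -> size (rho n p) = p.
Proof.
elim: p => // -[|p] IH lt; first by [].
rewrite rhoS /= ?IH //; lia.
Qed.

Lemma all_rho p : (0 < p <= r.*2)%N -> all (leq^~ r) (rho n p).
Proof.
elim: p => // -[|p] IH lt; first by [].
rewrite rhoS /= ?IH /rstep; last by lia.
  by case: ifP; lia.
by lia.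
Qed.

(** rho_p shifts the first [rpos p] coordinates down by one and puts the old m 0, reflected by s_0,
    in the last of these places. Beyond p = r the travelling coordinate has also been negated by s_r
    and moves back. *)
Lemma rho_act p m k : (0 < p <= r.*2)%N ->
  word_act (rho n p) m k =
  if (k.+1 < rpos p)%N then m k.+1
  else if k.+1 == rpos p then (if (p <= r)%N then 1 - m 0%N else m 0%N - 1)
  else m k.
Proof.
elim: p k => // -[|p] IH k lt.
  by rewrite /= /refl_act /rpos /=; case: k.
rewrite rhoS; last lia.
rewrite [word_act _ _ _]/(refl_act (rstep p.+1) (word_act (rho n p.+1) m) k).
have {}IH q : word_act (rho n p.+1) m q = if (q.+1 < rpos p.+1)%N then m q.+1
    else if q.+1 == rpos p.+1 then (if (p.+1 <= r)%N then 1 - m 0%N else m 0%N - 1)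
    else m q by apply: IH; lia.
have swapIH q : (q.+1 < r)%N -> (if (p.+1 <= r)%N then p.+1 else r.*2 - p.+1)%N = q.+1 ->
    word_act (rho n p.+1) m (swapn q k) =
    (if (k.+1 < rpos p.+2)%N then m k.+1
     else if k.+1 == rpos p.+2 then (if (p.+2 <= r)%N then 1 - m 0%N else m 0%N - 1) else m k).
  move=> lq qE.
  case: (k =P q) => [->|/eqP kq]; last case: (k =P q.+1) => [->|/eqP kq'].
  - rewrite swapnL IH; move: qE; rewrite /rpos.
    by repeat case: ifP => //; lia.
  - rewrite swapnR IH; move: qE; rewrite /rpos.
    by repeat case: ifP => //; lia.
  - rewrite swapn_id // IH; move: qE kq kq'; rewrite /rpos.
    by repeat case: ifP => //; lia.
have rs0 : rstep p.+1 != 0%N by rewrite /rstep; case: ifP; lia.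
rewrite /refl_act (negPf rs0); case: (eqVneq (rstep p.+1) r) => [E|E].
  have pr : p.+1 = r by move: E; rewrite /rstep; case: ifP; lia.
  have [pn _] := (pr, E); case: (eqVneq k n) => [->|kn]; rewrite IH /rpos.
    rewrite pr ltnn leqnn eqxx ltnn; have -> : (r.*2.+1 - r.+1 = r)%N by lia.
    by rewrite ltnn eqxx opprB.
  by repeat case: ifP => //; lia.
have [q qE] : exists q, rstep p.+1 = q.+1 by exists (rstep p.+1).-1; lia.
rewrite qE; apply: swapIH; last exact: qE.
by move: E qE; rewrite /rstep; case: ifP; lia.
Qed.

Lemma refl_act_last m k : refl_act r m k = if k == n then - m k else m k.
Proof. by rewrite /refl_act eqxx. Qed.

Lemma refl_act_mid i m k : (i.+1 < r)%N -> refl_act i.+1 m k = m (swapn i k).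
Proof. by move=> lt; rewrite /refl_act /= ifF //; apply/negbTE; lia. Qed.

Lemma refl_rho_above p i m : (0 < p <= r.*2)%N -> (rpos p < i <= r)%N ->
  refl_act i (word_act (rho n p) m) = word_act (rho n p) (refl_act i m).
Proof.
move=> lep /andP[lt le]; apply/funext => k; rewrite rho_act //.
have pos0 : (0 < rpos p)%N by rewrite /rpos; case: ifP; lia.
case: i lt le => // i lt le; case: (eqVneq i.+1 r) => [ir|ir].
  rewrite ir !refl_act_last !rho_act //.
  have -> : (0%N == n) = false by apply/negbTE; lia.
  case: (k =P n) => [->|/eqP kn].
    by repeat case: ifP => //; lia.
  by repeat case: ifP => //; lia.
have li : (i.+1 < r)%N by lia.
rewrite !refl_act_mid // !rho_act //.
case: (k =P i) => [->|/eqP ki]; last case: (k =P i.+1) => [->|/eqP ki'].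
- by rewrite swapnL; repeat case: ifP => //; lia.
- by rewrite swapnR; repeat case: ifP => //; lia.
- rewrite (swapn_id ki) //; case: ifP => c1.
    by rewrite swapn_id //; lia.
  by case: ifP => // c2; rewrite swapn_id //; lia.
Qed.

(** On these places rho_p is a shift by one, which conjugates s_(i+1) to s_i. *)
Lemma refl_rho_below p i m : (0 < p <= r.*2)%N -> (0 < i)%N -> (i.+1 < rpos p)%N ->
  refl_act i (word_act (rho n p) m) = word_act (rho n p) (refl_act i.+1 m).
Proof.
move=> lep i0 lt; apply/funext => k; rewrite rho_act //.
have posr : (rpos p <= r)%N by rewrite /rpos; case: ifP; lia.
case: i i0 lt => // i _ lt; rewrite !refl_act_mid ?rho_act //; try lia.
have -> : swapn i.+1 0 = 0%N by rewrite swapn_id.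
case: (k =P i) => [->|/eqP ki]; last case: (k =P i.+1) => [->|/eqP ki'].
- by rewrite !swapnL; repeat case: ifP => //; lia.
- by rewrite !swapnR; repeat case: ifP => //; lia.
- rewrite (swapn_id ki) //; case: ifP => c1; first by rewrite swapn_id //; lia.
  by case: ifP => // c2; rewrite swapn_id //; lia.
Qed.

(** The product puts 1 - m 1 and 1 - m 0 in the places i-1 and i; exchanging them amounts to
    exchanging m 0 and m 1. *)
Lemma refl_rho_pair i m : (0 < i < r)%N ->
  refl_act i (word_act (rho n i) (word_act (rho n i.+1) m)) =
  word_act (rho n i) (word_act (rho n i.+1) (refl_act 1 m)).
Proof.
case: i => // i lt; have lt' : (i.+1 < r)%N by lia.
have posE p : (p <= r)%N -> rpos p = p by rewrite /rpos => ->.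
have act q m' k : (q.+1 <= r)%N -> word_act (rho n q.+1) m' k =
    if (k < q)%N then m' k.+1 else if k == q then 1 - m' 0%N else m' k.
  by move=> lq; rewrite rho_act ?posE ?lq //; lia.
apply/funext => k; rewrite refl_act_mid // !act //; try lia.
rewrite !refl_act_mid ?swapnL ?swapnR; try lia.
have E q : (1 < q)%N -> swapn 0 q = q by move=> lq; rewrite swapn_id //; lia.
case: (k =P i) => [->|/eqP ki]; last case: (k =P i.+1) => [->|/eqP ki'].
- by rewrite swapnL; repeat case: ifP => //; try lia; rewrite ?E; lia.
- rewrite swapnR.
  repeat case: ifP => //; try lia.
- by rewrite (swapn_id ki) //; repeat case: ifP => //; try lia; move=> *; rewrite E //; lia.
Qed.
End WeylGroup.

Lemma strict_part_rcons la p : strict_part (rcons la p) ->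
  [/\ strict_part la, (0 < p)%N & all (ltn p) la].
Proof.
rewrite /strict_part mem_rcons inE negb_or => /andP[+ /andP[p0 ->]].
rewrite !(sorted_pairwise (rev_trans ltn_trans)) -cats1 pairwise_cat => /and3P[H -> _].
split=> //; first by rewrite lt0n eq_sym.
by apply/allP => q qla; have := allrelP H q p qla (mem_head _ _).
Qed.

(** * Left multiplication of w_la by a simple reflection *)

Section WeylWords.
Variable n : nat.
Local Notation r := n.+1.

Definition word (la : seq nat) : seq nat := flatten (rev (map (rho n) la)).
Local Notation W la := (wprod n (word la)).
Local Notation Rho p := (wprod n (rho n p)).

Lemma word_rcons la p : word (rcons la p) = rho n p ++ word la.
Proof. by rewrite /word map_rcons rev_rcons. Qed.

Lemma W_rcons la p : W (rcons la p) = (Rho p * W la)%g.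
Proof. by rewrite word_rcons wprod_cat. Qed.

Definition bounded_parts (la : seq nat) := all (fun p => 0 < p <= r.*2)%N la.

Lemma all_word la : bounded_parts la -> all (leq^~ r) (word la).
Proof.
elim/last_ind: la => // la p IH; rewrite /bounded_parts all_rcons => /andP[lep lela].
by rewrite word_rcons all_cat all_rho // IH.
Qed.

Lemma size_word la : bounded_parts la -> size (word la) = sumn la.
Proof.
elim/last_ind: la => // la p IH; rewrite /bounded_parts all_rcons => /andP[lep lela].
by rewrite word_rcons size_cat size_rho // IH // sumn_rcons addnC.
Qed.

Lemma sgen_sq i : (i <= r)%N -> (sgen n i * sgen n i)%g = 1%g.
Proof.
move=> le; transitivity (wprod n [:: i; i]); first by rewrite wprod_cons wprod1.
have -> : 1%g = wprod n [::] by rewrite /wprod big_nil.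
by apply: wprod_eq => //= [|m]; rewrite ?le // refl_actK.
Qed.

Lemma sgen_Rho p : (0 < p < r.*2)%N -> (sgen n (rstep n p) * Rho p)%g = Rho p.+1.
Proof. by move=> lt; rewrite rhoS // wprod_cons. Qed.

Lemma sgen_RhoS p : (0 < p < r.*2)%N -> (sgen n (rstep n p) * Rho p.+1)%g = Rho p.
Proof.
move=> lt; rewrite rhoS // wprod_cons mulgA sgen_sq ?mul1g //.
by rewrite /rstep; case: ifP; lia.
Qed.

Lemma sgen_Rho_above p i : (0 < p <= r.*2)%N -> (rpos n p < i <= r)%N ->
  (sgen n i * Rho p)%g = (Rho p * sgen n i)%g.
Proof.
move=> lep lt; rewrite -wprod_cons -wprod1 -wprod_cat; apply: wprod_eq => [||m].
- by rewrite /= all_rho // andbT; case/andP: lt.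
- by rewrite all_cat all_rho //= andbT; case/andP: lt.
- by rewrite word_act_cat -refl_rho_above.
Qed.

Lemma rpos_le p : (0 < p <= r.*2)%N -> (rpos n p <= r)%N.
Proof. by rewrite /rpos; case: ifP; lia. Qed.

Lemma sgen_Rho_below p i : (0 < p <= r.*2)%N -> (0 < i)%N -> (i.+1 < rpos n p)%N ->
  (sgen n i * Rho p)%g = (Rho p * sgen n i.+1)%g.
Proof.
move=> lep i0 lt; have lr := rpos_le lep.
rewrite -wprod_cons -wprod1 -wprod_cat; apply: wprod_eq => [||m].
- by rewrite /= all_rho // andbT; lia.
- by rewrite all_cat all_rho //= andbT; lia.
- by rewrite word_act_cat -refl_rho_below.
Qed.

Lemma sgen_Rho_pair i : (0 < i < r)%N ->
  (sgen n i * (Rho i * Rho i.+1))%g = (Rho i * (Rho i.+1 * sgen n 1))%g.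
Proof.
move=> lt; rewrite -!wprod1 -!wprod_cat; apply: wprod_eq => [||m].
- by rewrite /= all_cat !all_rho ?andbT //; lia.
- by rewrite !all_cat !all_rho //=; lia.
- by rewrite /= !word_act_cat refl_rho_pair.
Qed.

(** Each rho_p crossed raises the index by one, but the parts met also increase, so the index stays
    below them; the bound on the size leaves enough room when p > r. The reflection leaves on the
    right as an element of W. *)
Lemma sgen_pass c la : (0 < c <= r)%N -> strict_part la -> all (leq c.+2) la ->
  (sumn la + c < r.*2)%N ->
  exists2 k, (0 < k <= r)%N & (sgen n c * W la)%g = (W la * sgen n k)%g.
Proof.
elim/last_ind: la c => [|la p IH] c lec.
  by move=> _ _ _; exists c; rewrite // /wprod big_nil mul1g mulg1.
move=> /strict_part_rcons[sla p0 lap]; rewrite all_rcons sumn_rcons => /andP[cp _] lt.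
have lep : (0 < p <= r.*2)%N by lia.
have cpos : (c.+1 < rpos n p)%N by rewrite /rpos; case: ifP; lia.
have lr := rpos_le lep.
have [||||k kr E] := IH c.+1 => //; try lia.
  by apply/allP => q /(allP lap) /=; lia.
exists k => //; rewrite W_rcons mulgA sgen_Rho_below //; last by case/andP: lec.
by rewrite -!mulgA E.
Qed.

(** Induction on the smallest part p. Either s_i commutes with rho_p, or it turns rho_p into
    rho_(p+1) or rho_(p-1), or it slides through as s_(i+1) and then passes the larger parts. *)
Lemma sgen_step i la : (0 < i <= r)%N -> strict_part la -> (sumn la < r.*2)%N ->
  [\/ exists q, [/\ (q == i) || (q + i == r.*2)%N, q \in la, q.+1 \notin la
        & (sgen n i * W la)%g = W (map (swapn q) la)],
      exists s, [/\ all (leq^~ r) s, (size s < sumn la)%N & (sgen n i * W la)%g = wprod n s]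
    | exists2 k, (0 < k <= r)%N & (sgen n i * W la)%g = (W la * sgen n k)%g].
Proof.
move=> lei; elim/last_ind: la => [|la p IH].
  by move=> _ _; constructor 3; exists i; rewrite // /wprod big_nil mul1g mulg1.
move=> /strict_part_rcons[sla p0 lap]; rewrite sumn_rcons => lt.
have lep : (0 < p <= r.*2)%N by lia.
have ltp : (0 < p < r.*2)%N by lia.
have pla : p \notin la by apply/negP => /(allP lap) /=; rewrite ltnn.
have bla : bounded_parts la.
  apply/allP => q qla; have := allP lap _ qla => /=.
  have : (q <= sumn la)%N by elim: (la) qla => //= m mu IHm; rewrite inE => /predU1P[->|/IHm]; lia.
  lia.
have lr := rpos_le lep.
have [above|le] := ltnP (rpos n p) i.
  have [||[q [qi qla q1la E]]|[s [ls ss E]]|[k kr E]] := IH => //; first lia.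
  - constructor 1; exists q; have ltq := allP lap _ qla; rewrite /= in ltq.
    split=> //; first by rewrite mem_rcons inE qla orbT.
      by rewrite mem_rcons inE negb_or q1la andbT; lia.
    rewrite map_rcons !W_rcons swapn_id; try lia.
    by rewrite mulgA sgen_Rho_above ?above ?(andP lei).2 // -mulgA E.
  - constructor 2; exists (rho n p ++ s); split.
    + by rewrite all_cat all_rho.
    + by rewrite size_cat size_rho //; lia.
    + by rewrite W_rcons mulgA sgen_Rho_above ?above ?(andP lei).2 // -mulgA E wprod_cat.
  - constructor 3; exists k => //.
    by rewrite W_rcons mulgA sgen_Rho_above ?above ?(andP lei).2 // -!mulgA E.
have [ip|ip] := eqVneq i (rstep n p).
  have [p1la|p1la] := boolP (p.+1 \in la); last first.
    constructor 1; exists p; split.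
    - by rewrite ip /rstep; case: ifP => _; lia.
    - by rewrite mem_rcons mem_head.
    - by rewrite mem_rcons inE negb_or p1la andbT; lia.
    rewrite map_rcons !W_rcons swapnL mulgA ip sgen_Rho //; congr (_ * W _)%g.
    rewrite map_id_in // => q qla; rewrite swapn_id //.
      by apply: contraNneq pla => <-.
    by apply: contraNneq p1la => <-.
  (* The parts p+1 and p are consecutive and p < r by the size bound: s_p leaves their product as
     s_1, which passes the remaining parts, all at least 3. *)
  case/lastP: la p1la sla lap lt bla pla {IH} => // la q p1la.
  move=> /strict_part_rcons[sla q0 laq]; rewrite all_rcons sumn_rcons => /andP[/= pq lap] lt _ _.
  have qE : q = p.+1.
    by move: p1la; rewrite mem_rcons inE => /orP[/eqP //|/(allP laq)] /=; lia.
  have pr : (p < r)%N by lia.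
  have iE : i = p by rewrite ip /rstep ltnW.
  have [||||k kr E] := @sgen_pass 1 la => //.
  - by apply/allP => x /(allP laq) /=; lia.
  - lia.
  constructor 3; exists k => //; rewrite !W_rcons qE iE.
  rewrite [(Rho p * _)%g]mulgA mulgA sgen_Rho_pair; last by rewrite p0.
  by rewrite -!mulgA E.
have [p1|p1] := eqVneq p 1%N; first by move: le lei; rewrite p1 /rpos /=; move: ip; rewrite p1 /rstep /=; lia.
have pE : p.-1.+1 = p by lia.
have [ip'|ip'] := eqVneq i (rstep n p.-1).
  (* s_i cancels the leftmost letter of rho_p. *)
  constructor 2; exists (rho n p.-1 ++ word la); split.
  - by rewrite all_cat all_word // all_rho //; lia.
  - by rewrite size_cat size_word // size_rho; lia.
  - by rewrite W_rcons mulgA wprod_cat -{1}pE ip' sgen_RhoS //; lia.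
have below : (i.+1 < rpos n p)%N.
  by move: ip ip' le; rewrite /rstep /rpos; do 2?case: ifP; lia.
have rp : (rpos n p <= p)%N by rewrite /rpos; case: ifP; lia.
constructor 3; have [||||k kr E] := @sgen_pass i.+1 la => //.
- lia.
- by apply/allP => q /(allP lap) /=; lia.
- lia.
exists k => //; rewrite W_rcons mulgA sgen_Rho_below ?(andP lei).1 //.
by rewrite -!mulgA E.
Qed.
End WeylWords.

(** * Injectivity of la |-> w_la *)

Section Decoding.
Variable n : nat.
Local Notation r := n.+1.
Local Notation W la := (wprod n (word n la)).

(* Signs of the coordinates of w_la . 0, from which the smallest part p of la
   (0 if la is empty) can be read off. *)
Definition sign_pattern (p : nat) (v : nat -> int) : Prop :=
  if p == 0%N then forall k, v k = 0
  else if (p <= r)%N then (forall k, (k.+1 < p)%N -> v k <= 0) /\ 0 < v p.-1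
  else [/\ forall k, v k <= 0, v (rpos n p).-1 < 0 & forall k, (rpos n p <= k)%N -> v k = 0].

Lemma sign_pattern_inj p q v : (p <= r.*2)%N -> (q <= r.*2)%N ->
  sign_pattern p v -> sign_pattern q v -> p = q.
Proof.
move=> lep leq_q; rewrite /sign_pattern.
case: (eqVneq p 0%N) => [->|p0] vp; case: (eqVneq q 0%N) => [->|q0] vq //; move: vp vq.
- move=> v0; case: ifP => _ [] *; [have := v0 q.-1 | have := v0 (rpos n q).-1]; lia.
- move=> + v0; case: ifP => _ [] *; [have := v0 p.-1 | have := v0 (rpos n p).-1]; lia.
case: ifP => pr; case: ifP => qr.
- move=> [vp vp1] [vq vq1]; case: (ltngtP p q) => // lt.
    by have := vq p.-1; lia.
  by have := vp q.-1; lia.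
- by move=> [_ vp1] [vq _ _]; have := vq p.-1; lia.
- by move=> [vp _ _] [_ vq1]; have := vp q.-1; lia.
- move=> [_ vp1 vp0] [_ vq1 vq0]; move: vp1 vp0 vq1 vq0; rewrite /rpos pr qr => vp1 vp0 vq1 vq0.
  case: (ltngtP p q) => // lt.
    by have := vq0 (r.*2.+1 - p).-1; lia.
  by have := vp0 (r.*2.+1 - q).-1; lia.
Qed.

Lemma partC_rcons la p : partC n (rcons la p) ->
  [/\ partC n la, (0 < p <= r.*2)%N, all (leq p) la & (p <= r)%N -> p \notin la].
Proof.
case/and3P => st; rewrite all_rcons => /andP[lep lela] /allP ct.
have ge_tr : transitive geq by move=> x y z /= xy yz; exact: leq_trans yz xy.
have pla : all (leq p) la.
  move: st; rewrite (sorted_pairwise ge_tr) -cats1 pairwise_cat => /and3P[/allrelP H _ _].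
  by apply/allP => q qla; apply: H; rewrite ?mem_head.
split=> //.
  apply/and3P; split=> //.
    by move: st; rewrite !(sorted_pairwise ge_tr) -cats1 pairwise_cat => /and3P[].
  by apply/allP => k /ct; rewrite -cats1 count_cat; lia.
move=> pr; have pI : p \in iota 1 r by rewrite mem_iota; lia.
by have := ct p pI; rewrite -cats1 count_cat /= eqxx -has_pred1 has_count -leqNgt addn0 addn1 ltnS.
Qed.

Lemma partC_bounded la : partC n la -> bounded_parts n la.
Proof. by case/and3P. Qed.

(** For p <= r the next part is strictly larger, so the coordinates that rho_p shifts are
    nonpositive and the new one, 1 - v 0, is positive. For p > r all parts exceed r and the new
    coordinate v 0 - 1 is negative. *)
Lemma sign_pattern_word la : partC n la ->
  sign_pattern (last 0%N la) (word_act n (word n la) (fun=> 0)).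
Proof.
elim/last_ind: la => // la p IH /partC_rcons[/[dup] pla /IH {}IH lep /allP ple pnla].
rewrite last_rcons word_rcons word_act_cat; set v := word_act n (word n la) _ in IH *.
have p0 : (p == 0%N) = false by apply/negbTE; lia.
have lq : (last 0%N la <= r.*2)%N.
  case/lastP: (la) (partC_bounded pla) => // l q; rewrite /bounded_parts all_rcons last_rcons.
  by case/andP => /andP[].
have pq : last 0%N la = 0%N \/ (p <= last 0%N la)%N /\ ((p <= r)%N -> (p < last 0%N la)%N).
  case/lastP: (la) ple pnla => [|l q] ple pnla; [by left | right].
  rewrite last_rcons; have := ple q; rewrite mem_rcons mem_head => /(_ isT) le; split=> // pr.
  by have := pnla pr; rewrite mem_rcons inE negb_or => /andP[ne _]; lia.
move: (last 0%N la) IH lq pq => q; rewrite /sign_pattern p0 => IH lq pq.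
have act k := rho_act v k lep.
case: ifP act => pr act.
  have vle k : (k.+1 < p)%N || (k == 0%N) -> v k <= 0.
    move=> lt; move: IH; case: eqP => [_ -> //|q0]; case: ifP => qr; last by case=> H _ _; exact: H.
    by case=> H _; apply: H; case: pq; lia.
  have posE : rpos n p = p by rewrite /rpos pr.
  split=> [k lk|].
    rewrite act posE lk; move: IH; case: eqP => [_ -> //|q0].
    by case: ifP => qr; [case=> + _; apply; case: pq => []; lia | case=> + _ _; apply].
  rewrite act posE prednK ?ltnn ?eqxx; last lia.
  by have := vle 0%N (orbT _); lia.
have {IH} [vle vz] : (forall k, v k <= 0) /\ (forall k, (rpos n p <= k)%N -> v k = 0).
  move: IH; case: eqP => [_ v0|q0]; first by split=> k; rewrite v0.
  case: ifP => qr; first by case: pq; lia.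
  by case=> vle _ v0; split=> // k lk; apply: v0; move: lk; rewrite /rpos qr pr; lia.
have pos0 : (0 < rpos n p)%N by rewrite /rpos pr; lia.
split=> [k||k lk]; rewrite act.
- by repeat case: ifP => // _; have := vle 0%N; lia.
- by rewrite prednK // ltnn eqxx; have := vle 0%N; lia.
- by rewrite !ifF ?vz //; apply/negbTE; lia.
Qed.

Lemma wprod_word_inj la mu : partC n la -> partC n mu -> W la = W mu -> la = mu.
Proof.
have zero : coord (0 : {ffun 'I_r -> int}) = fun=> 0.
  by apply/funext => k; rewrite /coord ffunE if_same.
have lastE l m : partC n l -> partC n m -> W l = W m -> last 0%N l = last 0%N m.
  move=> pl pm E.
  have bnd l' : partC n l' -> (last 0%N l' <= r.*2)%N.
    move/partC_bounded; case/lastP: l' => // l' q.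
    by rewrite /bounded_parts all_rcons last_rcons => /andP[/andP[]].
  have actE : word_act n (word n l) (fun=> 0) = word_act n (word n m) (fun=> 0).
    by rewrite -zero -!coord_wprod ?E ?all_word ?partC_bounded.
  apply: (sign_pattern_inj (bnd _ pl) (bnd _ pm) (sign_pattern_word pl)).
  by rewrite actE; exact: sign_pattern_word.
elim/last_ind: la mu => [|la p IH] mu pla pmu E; have := lastE _ _ pla pmu E.
  case/lastP: mu pmu {E} => // mu q /partC_rcons[_ lq _ _].
  by rewrite last_rcons /= => q0; lia.
case/lastP: mu pmu E => [|mu q] pmu E; rewrite !last_rcons.
  by have [_ lp _ _] := partC_rcons pla => /= p0; lia.
move=> pq; rewrite pq; congr (rcons _ q); apply: IH.
- by case/partC_rcons: pla.
- by case/partC_rcons: pmu.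
- by move: E; rewrite !W_rcons pq => /mulgI.
Qed.

Lemma strict_partC la : strict_part la -> (sumn la <= r.*2)%N -> partC n la.
Proof.
move=> sla le; have /andP[st la0] := sla; apply/and3P; split.
- by apply: sub_sorted st => x y /=; exact: ltnW.
- apply/allP => k kla; have := leq_sumn kla; rewrite lt0n.
  by have -> /= : k != 0%N by [apply: contraNneq la0 => <-]; lia.
- apply/allP => k _; rewrite count_uniq_mem ?leq_b1 //.
  exact: strict_part_uniq.
Qed.
End Decoding.

(** * Length and reduced words *)

Section Length.
Variable n : nat.
Local Notation r := n.+1.

Lemma wlen_wprod s : all (leq^~ r) s -> (wlen (wprod n s) <= size s)%N.
Proof.
move=> les; pose t := [seq inord i : 'I_r.+1 | i <- s].
have tE : map val t = s.
  rewrite -map_comp map_id_in // => i /(allP les) /= le_i.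
  by rewrite inordK.
have : has_word (wprod n s) (size t) by apply/existsP; exists (in_tuple t); rewrite tE.
by rewrite /wlen size_map; case: ex_minnP => m _; apply.
Qed.

Lemma redwordP (x : waf r) :
  [/\ all (leq^~ r) (redword x), size (redword x) = wlen x & wprod n (redword x) = x].
Proof.
have := xchooseP (existsP (wlenP x)); rewrite /redword.
set t := xchoose _; move: t => t /eqP E.
split=> //; last by rewrite size_map size_tuple.
by apply/allP => _ /mapP[i _ ->]; rewrite -ltnS ltn_ord.
Qed.

Lemma wlen_sgen i (x : waf r) : (i <= r)%N -> (wlen (sgen n i * x)%g <= (wlen x).+1)%N.
Proof.
move=> le; have [lex sx xE] := redwordP x.
rewrite -{1}xE -wprod_cons -sx; apply: (@wlen_wprod (i :: redword x)).
by rewrite /= le.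
Qed.

Lemma sgen_fin k : (0 < k)%N -> sgen n k = Waf 0 (srefl n k).
Proof. by rewrite /sgen; case: k. Qed.
End Length.

Lemma sumn_swap q la : strict_part la -> q \in la -> q.+1 \notin la ->
  sumn (map (swapn q) la) = (sumn la).+1.
Proof.
move=> /strict_part_uniq U qla; elim: la qla U => //= m la IH; rewrite !inE negb_or => /predU1P[<-|qla] /andP[mla U] /andP[qm q1la].
  rewrite swapnL map_id_in // => k kla; rewrite swapn_id //.
    by apply: contraNneq mla => <-.
  by apply: contraNneq q1la => <-.
rewrite IH // swapn_id ?addnS //; last by rewrite eq_sym.
by apply: contraNneq mla => ->.
Qed.

(** * Induction along a reduced word *)

Section Main.
Variables (K : numFieldType) (n : nat) (P : seq nat -> hLambda (cpoly K)).
Hypothesis PP : dual_factorial_P P.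
Local Notation r := n.+1.
Local Notation Pa := (Psub P (@mpolyC n.+1 K) (@aper K n)).
Local Notation W la := (wprod n (word n la)).

Lemma divdiff_reduced_word s : all (leq^~ r) s -> size s = wlen (wprod n s) ->
  min_coset_rep (wprod n s) -> (size s <= r.*2)%N ->
  exists la, [/\ strict_part la, sumn la = size s, W la = wprod n s &
    foldr (@divdiff K n) 1 s = Pa la].
Proof.
elim: s => [|i s IH] /=.
  by move=> _ _ _ _; exists [::]; rewrite (Psub_nil PP).
move=> /andP[le_i les]; rewrite wprod_cons => sz mc le.
set w := wprod n s in sz mc *.
have len1 := wlen_sgen w le_i; have len2 := wlen_wprod les; rewrite -/w in len2.
have sw : size s = wlen w by apply/eqP; rewrite eqn_leq len2 andbT -ltnS sz.
(* If w v were shorter than w for some v in W, then s_i w v would be shorter than s_i w. *)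
have mcw : min_coset_rep w.
  apply/forallP => v; have /forallP /(_ v) := mc.
  rewrite -mulgA => le_v; have lt_v := wlen_sgen (w * Waf 0 v)%g le_i.
  by rewrite -sw -ltnS sz (leq_trans le_v lt_v).
have [la [sla sumE WE ->]] := IH les sw mcw (ltnW le).
have lt : (sumn la < r.*2)%N by rewrite sumE.
  have bla : bounded_parts n la by apply/partC_bounded/strict_partC => //; exact: ltnW.
  have lenW := wlen_wprod (all_word bla); rewrite size_word // in lenW.
  rewrite -/w in WE; rewrite -WE in sz mc *.
  have [i0|i0] := eqVneq i 0%N.
    rewrite i0 in sz mc *; have [la1|la1] := boolP (1%N \in la).
      (* Here s_0 = rho_1 would cancel the part 1 and decrease the length, against reducedness. *)
      have [mu laE mu2] := strict_part_rcons1 sla la1.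
      have bmu : bounded_parts n mu by move: bla; rewrite laE /bounded_parts all_rcons => /andP[].
      have := wlen_wprod (all_word bmu); rewrite size_word //.
      move: sz; rewrite {1}laE W_rcons rho1 wprod1 mulgA sgen_sq // mul1g => sz.
      by move: sumE; rewrite laE sumn_rcons; lia.
    exists (rcons la 1%N); split.
    + exact/strict_rcons1/strict_part_gt1.
    + by rewrite sumn_rcons sumE addn1.
    + by rewrite W_rcons rho1 wprod1.
    + by rewrite divdiff_first.
  have lei : (0 < i <= r)%N by rewrite lt0n i0.
  have [[q [qi qla q1la E]]|[t [let_ st E]]|[k lek E]] := sgen_step lei sla lt.
  + exists (map (swapn q) la); split=> //.
    * case: q qla q1la {qi E} => [|q] qla q1la; first by case/andP: sla; rewrite qla.
      by apply: strict_part_swap; rewrite // (negPf q1la).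
    * by rewrite sumn_swap // sumE.
    * exact: divdiff_up.
  + by have := wlen_wprod let_; rewrite -E -sz; lia.
  (* s_i w = w s_k, so right multiplication by s_k gives back the shorter element w, against
     minimality in the coset. *)
  + have /forallP /(_ (srefl n k)) := mc.
    rewrite -sgen_fin; last by case/andP: lek.
    by rewrite E -mulgA sgen_sq ?(andP lek).2 // mulg1 -E -sz; lia.
Qed.

Lemma Paff_Psub (w : waf r) : min_coset_rep w -> (wlen w <= r.*2)%N ->
  strict_part (lambda_of w) /\ Paff K w = Pa (lambda_of w).
Proof.
move=> mc le; have [lew sw wE] := redwordP w.
have [|||la [sla sumE WE E]] := divdiff_reduced_word lew; rewrite ?wE ?sw //.
have pla : partC n la by apply: strict_partC; rewrite // sumE sw.
(* la shows that the choice defining [lambda_of] has a solution, and injectivity makes this solution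
   la. *)
suff -> : lambda_of w = la by split.
rewrite /lambda_of; set Q := fun _ => _; have [] : Q (the [::] Q).
  by apply: theP; exists la; split; rewrite // -[RHS]wE -WE.
move=> pm Wm; apply: (wprod_word_inj pm pla).
by rewrite WE wE -[RHS]Wm.
Qed.
End Main.

(* C is R[i] and the rank is n.+1; Phat is the family of dual factorial
   P-functions with parameters a_1, a_2, ... *)
Theorem theorem1p2 (R : realType) (n : nat) (w : waf n.+1)
    (Phat : seq nat -> hLambda (cpoly R[i])) :
  dual_factorial_P Phat ->
  min_coset_rep w ->
  (wlen w <= 2 * n.+1)%N ->
  strict_part (lambda_of w) /\
  Paff R[i] w =
    hmap (asubst (@mpolyC n.+1 R[i]) (@aper R[i] n)) (Phat (lambda_of w)).
Proof. by rewrite mul2n => PP mc le; exact: Paff_Psub. Qed.
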